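(* Let $n\ge 2$ and $m\ge 2$ be integers with $m\ge\sqrt{n}$, and let $B_1,\ldots,B_m$ be mutually unbiased orthonormal bases of $\mathbb{C}^n$. Let $\mathfrak{B}=\bigsqcup_{i=1}^m B_i$ (a set of $mn$ unit vectors). Choose $p$ vectors $s(1),\ldots,s(p)$ uniformly and independently from $\mathfrak{B}$, and let $\Phi_n$ be the $p\times n$ random matrix whose $i$-th row is $s(i)$. Let $\mathcal{G}_n=\Phi_n\Phi_n^*$ (where $\Phi_n^*$ is the conjugate transpose), and let $F_{\mathcal{G}_n}$ be its empirical spectral distribution. Then, for every $x\in\mathbb{R}$, as $n\to\infty$ with $p=p(n)$ and $m=m(n)\ge \sqrt n$ chosen so that $y=\frac{p}{n}\in(0,1)$ is fixed, we have $$F_{\mathcal{G}_n}(x)\to F_{\mathrm{MP},y}(x)\quad\text{in probability},$$ where $F_{\mathrm{MP},y}$ is the cumulative distribution function of the Marchenko–Pastur law with density $$f_{\mathrm{MP},y}(x)=\frac{1}{2\pi xy}\sqrt{(b-x)(x-a)}\,\mathbbm{1}_{[a,b]}(x),\qquad a=(1-\sqrt{y})^2,\quad b=(1+\sqrt{y})^2 .$$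
   Context: Orthonormal bases $B_1,\ldots,B_m$ of $\mathbb{C}^n$ are called mutually unbiased if for all $i\ne j$ and all $u\in B_i$, $v\in B_j$ one has $|\langle u,v\rangle|=\frac{1}{\sqrt n}$, where $\langle\cdot,\cdot\rangle$ is the standard Hermitian inner product on $\mathbb{C}^n$. For a $p\times p$ Hermitian matrix $\mathbf{A}$ with eigenvalues $\lambda_1,\ldots,\lambda_p$, its empirical spectral distribution is $F_{\mathbf{A}}(x)=\frac1p\#\{i:\lambda_i\le x\}$. The entries of $\mathcal{G}_n$ are $(\mathcal{G}_n)_{ij}=\langle s(i),s(j)\rangle$. $\mathbbm{1}_{[a,b]}$ denotes the indicator function of $[a,b]$. *)

(* Defs.v *)
From HB Require Import structures.
From mathcomp Require Import all_boot all_order all_algebra.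
From mathcomp Require Import all_classical all_reals all_analysis.
From mathcomp Require Import complex.

Set Implicit Arguments.
Unset Strict Implicit.
Unset Printing Implicit Defensive.

Import Order.TTheory GRing.Theory Num.Theory.
Local Open Scope ring_scope.

Section Defs.
Variable R : realType.
Local Notation C := (R[i]).

Definition hdot (n : nat) (u v : 'rV[C]_n) : C := \sum_(k < n) u 0 k * (v 0 k)^*.

Definition orthonormal_basis (n : nat) (M : 'M[C]_n) : Prop :=
  forall a b : 'I_n, hdot (row a M) (row b M) = (a == b)%:R.

Definition mutually_unbiased (n m : nat) (B : 'I_m -> 'M[C]_n) : Prop :=
  (forall i, orthonormal_basis (B i)) /\
  (forall i j : 'I_m, i != j -> forall a b : 'I_n,
      `| hdot (row a (B i)) (row b (B j)) | = (sqrtC (n%:R : C))^-1).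

Definition adjmx (p n : nat) (A : 'M[C]_(p, n)) : 'M[C]_(n, p) := map_mx Num.conj A^T.

Lemma char_poly_splits (p : nat) (A : 'M[C]_p) :
  exists rs : seq C, char_poly A == \prod_(r <- rs) ('X - r%:P).
Proof.
have [rs Hrs] := closed_field_poly_normal (char_poly A).
exists rs; apply/eqP; rewrite {1}Hrs.
by rewrite (monicP (char_poly_monic A)) scale1r.
Qed.

Definition eigenvalues (p : nat) (A : 'M[C]_p) : seq C := xchoose (char_poly_splits A).

Definition esd (p : nat) (A : 'M[C]_p) (x : R) : R :=
  (count (fun l => l <= (x%:C)%C) (eigenvalues A))%:R / p%:R.

Definition mp_a (y : R) : R := (1 - Num.sqrt y) ^+ 2.
Definition mp_b (y : R) : R := (1 + Num.sqrt y) ^+ 2.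
Definition mp_density (y : R) (t : R) : R :=
  if (mp_a y <= t <= mp_b y) then
    (2 * pi * t * y)^-1 * Num.sqrt ((mp_b y - t) * (t - mp_a y))
  else 0.
Definition mp_cdf (y : R) (x : R) : R :=
  \int[lebesgue_measure]_(t in `]-oo, x]) mp_density y t.

Definition Phi_of (n m p : nat) (B : 'I_m -> 'M[C]_n) (s : {ffun 'I_p -> 'I_m * 'I_n})
  : 'M[C]_(p, n) := \matrix_(i < p, k < n) B (s i).1 (s i).2 k.
Definition gram_of (n m p : nat) (B : 'I_m -> 'M[C]_n) (s : {ffun 'I_p -> 'I_m * 'I_n})
  : 'M[C]_p := Phi_of B s *m adjmx (Phi_of B s).

Definition dev_prob (n m p : nat) (B : 'I_m -> 'M[C]_n) (y x eps : R) : R :=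
  #|[set s : {ffun 'I_p -> 'I_m * 'I_n} | eps < `| esd (gram_of B s) x - mp_cdf y x |]|%:R
  / ((m * n) ^ p)%:R.

End Defs.

(* Main.v *)
(** For t > 0 let Q = (Phi^* Phi + t)^-1 (n x n).  Deleting the i-th row s_i of
    Phi changes Q by a rank-one update, so that
      t tr (G + t)^-1 = sum_i 1 / (1 + q_i),   q_i = s_i Q_i s_i^*,
    where Q_i is independent of s_i, and tr Q / n is an approximate solution of
    t g = 1 - y + y / (1 + g).  The only probabilistic input is that q_i is close
    to tr Q_i / n in mean square: the traceless parts of the projectors on the
    vectors of distinct unbiased bases are orthogonal for the Hilbert-Schmidt
    product, so by Bessel's inequality the variance of q_i is at most
    |Q_i|_HS^2 / (m n) <= 1 / (m t^2), and m >= sqrt n tends to infinity.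
    The scalar equation is stable, which gives the convergence in mean of the
    Stieltjes transforms at all t > 0.  Its root is the transform of the
    Marchenko-Pastur law, computed from an explicit primitive.  Difference
    quotients in t and Bernstein polynomials in 1 / (1 + x) then give the
    convergence of the distribution functions. *)
Require Import Defs.
From HB Require Import structures.
From mathcomp Require Import all_boot all_order all_algebra.
From mathcomp Require Import all_classical all_reals all_analysis.
From mathcomp Require Import complex.
From mathcomp Require Import ring lra.
Import Order.TTheory GRing.Theory Num.Theory.
Import numFieldNormedType.Exports.
Local Open Scope classical_set_scope.
Local Open Scope ring_scope.
Set Implicit Arguments.
Unset Strict Implicit.
Unset Printing Implicit Defensive.

Local Notation "A ^*m" := (adjmx A) (at level 2, format "A ^*m").

(** * Resolvents *)

Section Resolvent.
Variable R : realType.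
Local Notation C := (R[i]).

Lemma adjmxE (m n : nat) (A : 'M[C]_(m, n)) i j : A^*m i j = (A j i)^*.
Proof. by rewrite !mxE. Qed.

Lemma adjmxK (m n : nat) (A : 'M[C]_(m, n)) : A^*m^*m = A.
Proof. by apply/matrixP => i j; rewrite !adjmxE conjCK. Qed.

Lemma adjmxM (m n p : nat) (A : 'M[C]_(m, n)) (B : 'M[C]_(n, p)) :
  (A *m B)^*m = B^*m *m A^*m.
Proof. by rewrite /adjmx trmx_mul map_mxM. Qed.

Lemma adjmxD (m n : nat) (A B : 'M[C]_(m, n)) : (A + B)^*m = A^*m + B^*m.
Proof. by rewrite /adjmx linearD map_mxD. Qed.

Lemma adjmx_scalar (n : nat) (t : R) : (t%:C%C%:M : 'M[C]_n)^*m = t%:C%C%:M.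
Proof. by rewrite /adjmx tr_scalar_mx map_scalar_mx; congr (_%:M); exact: conjc_real. Qed.

Lemma mxtrace_mul_adj (m n : nat) (A : 'M[C]_(m, n)) :
  \tr (A *m A^*m) = \sum_i \sum_j `|A i j| ^+ 2.
Proof.
apply: eq_bigr => i _; rewrite mxE; apply: eq_bigr => j _.
by rewrite adjmxE normCK.
Qed.

Lemma mxtrace_mul_adj_ge0 (m n : nat) (A : 'M[C]_(m, n)) : 0 <= \tr (A *m A^*m).
Proof.
by rewrite mxtrace_mul_adj !sumr_ge0// => i _; rewrite sumr_ge0// => j _; rewrite exprn_ge0.
Qed.

Lemma mul_adj_eq0 (n : nat) (v : 'rV[C]_n) : (v *m v^*m) 0 0 = 0 -> v = 0.
Proof.
rewrite -trace_mx11 mxtrace_mul_adj big_ord1 => /psumr_eq0P v0.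
apply/rowP => j; rewrite mxE; apply/eqP; rewrite -normr_eq0 -sqrf_eq0.
by apply/eqP/v0 => // k _; rewrite exprn_ge0.
Qed.

Lemma mul_adj11_ge0 (n : nat) (v : 'rV[C]_n) : 0 <= (v *m v^*m) 0 0.
Proof. by rewrite -trace_mx11 mxtrace_mul_adj_ge0. Qed.

(** The resolvent of the n x n matrix at the point -t. On the negative half-line it is Hermitian and
    positive, so real inequalities suffice. *)
Definition resolvent (t : R) (p n : nat) (F : 'M[C]_(p, n)) : 'M[C]_n :=
  invmx (F^*m *m F + t%:C%C%:M).

Section Fixed.
Variables (t : R) (t0 : 0 < t).
Local Notation tc := (t%:C%C).

Let tc0 : 0 < tc :> C. Proof. by rewrite ltcR. Qed.

(** A row v in the kernel satisfies |v F^*|^2 + t |v|^2 = 0, a sum of two nonnegative terms, hence v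
    = 0. *)
Lemma reg_unit (p n : nat) (F : 'M[C]_(p, n)) : F^*m *m F + tc%:M \in unitmx.
Proof.
rewrite -row_free_unit; apply: inj_row_free => v vM0; apply: mul_adj_eq0.
have : (v *m (F^*m *m F + tc%:M) *m v^*m) 0 0 = 0 by rewrite vM0 mul0mx mxE.
rewrite mulmxDr mulmxDl mul_mx_scalar -scalemxAl mulmxA -(mulmxA _ F).
rewrite -{2}(adjmxK F) -adjmxM mxE [X in _ + X]mxE => /eqP.
rewrite paddr_eq0 ?mul_adj11_ge0 ?mulr_ge0 ?mul_adj11_ge0 ?(ltW tc0)//.
by rewrite mulf_eq0 (gt_eqF tc0) => /andP[_ /eqP].
Qed.

Section Res.
Variables (p n : nat) (F : 'M[C]_(p, n)).
Local Notation Q := (resolvent t F).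

Lemma resolventM : Q *m (F^*m *m F + tc%:M) = 1%:M.
Proof. by rewrite mulVmx// reg_unit. Qed.

Lemma resolventMr : (F^*m *m F + tc%:M) *m Q = 1%:M.
Proof. by rewrite mulmxV// reg_unit. Qed.

Lemma resolvent_adj : Q^*m = Q.
Proof.
have : Q^*m *m (F^*m *m F + tc%:M) = 1%:M.
  have := congr1 (@adjmx R n n) resolventMr.
  by rewrite adjmxM adjmxD adjmxM adjmxK !adjmx_scalar.
by move=> /(congr1 (mulmx ^~ Q)); rewrite -mulmxA resolventMr mulmx1 mul1mx.
Qed.

(* Q = Q (F^* F + t) Q splits the form s Q s^* into two squares. *)
Lemma resolvent_form (s : 'rV[C]_n) :
  (s *m Q *m s^*m) 0 0 =
  ((s *m Q *m F^*m) *m (s *m Q *m F^*m)^*m) 0 0 + tc * (s *m Q *m Q *m s^*m) 0 0.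
Proof.
have {1}-> : Q = Q *m (F^*m *m F + tc%:M) *m Q by rewrite resolventM mul1mx.
rewrite !adjmxM adjmxK resolvent_adj mulmxDr mulmxDl mulmxDr mulmxDl mxE.
by rewrite !mulmxA mul_mx_scalar -!scalemxAl [X in _ + X]mxE.
Qed.

Lemma resolvent_sqr_ge0 (s : 'rV[C]_n) : 0 <= (s *m Q *m Q *m s^*m) 0 0.
Proof. by have := mul_adj11_ge0 (s *m Q); rewrite adjmxM resolvent_adj !mulmxA. Qed.

(** Drops the first square of [resolvent_form]; this is what bounds the change of the trace under a
    rank-one update. *)
Lemma resolvent_form_ge (s : 'rV[C]_n) :
  tc * (s *m Q *m Q *m s^*m) 0 0 <= (s *m Q *m s^*m) 0 0.
Proof. by rewrite resolvent_form lerDr mul_adj11_ge0. Qed.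

Lemma resolvent_form_ge0 (s : 'rV[C]_n) : 0 <= (s *m Q *m s^*m) 0 0.
Proof.
by apply: le_trans (resolvent_form_ge s); rewrite mulr_ge0 ?resolvent_sqr_ge0 ?(ltW tc0).
Qed.

Lemma mxtrace_resolvent_ge0 : 0 <= \tr Q.
Proof.
apply: sumr_ge0 => i _; pose d : 'rV[C]_n := delta_mx 0 i.
suff <- : (d *m Q *m d^*m) 0 0 = Q i i by exact: resolvent_form_ge0.
have -> : d *m Q = row i Q by rewrite rowE.
rewrite mxE (bigD1 i)//= big1 ?addr0 => [|j /negPf ji].
  by rewrite !mxE !eqxx conjC1 mulr1.
by rewrite !mxE eqxx ji /= conjC0 mulr0.
Qed.

(** Expand the squared Hilbert-Schmidt norm of 1 = Q F^* F + t Q: the cross terms are multiples of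
    |Q F^*|^2, hence nonnegative, and the left side has squared norm n. *)
Lemma resolvent_HS : tc ^+ 2 * \tr (Q *m Q^*m) <= n%:R.
Proof.
have e : (Q *m F^*m *m F + tc *: Q) = 1%:M.
  by rewrite -resolventM mulmxDr mul_mx_scalar mulmxA.
have -> : n%:R = \tr ((1%:M : 'M[C]_n) *m (1%:M)^*m).
  by rewrite /adjmx trmx1 map_mx1 mulmx1 mxtrace1.
have eZ : (tc *: Q)^*m = tc *: Q.
  by rewrite -{1}mul_mx_scalar adjmxM adjmx_scalar resolvent_adj mul_scalar_mx.
rewrite -{1}e; rewrite -e adjmxD eZ mulmxDl !mulmxDr !mxtraceD.
have e1 : 0 <= \tr (Q *m F^*m *m F *m (tc *: Q)).
  rewrite -scalemxAr mxtraceZ mulr_ge0 ?(ltW tc0)//.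
  have := mxtrace_mul_adj_ge0 (Q *m F^*m).
  by rewrite adjmxM adjmxK resolvent_adj !mulmxA.
have e2 : 0 <= \tr (tc *: Q *m (Q *m F^*m *m F)^*m).
  rewrite -scalemxAl mxtraceZ mulr_ge0 ?(ltW tc0)//.
  have := mxtrace_mul_adj_ge0 (Q *m F^*m).
  by rewrite !adjmxM adjmxK resolvent_adj !mulmxA.
have -> : tc ^+ 2 * \tr (Q *m Q^*m) = \tr (tc *: Q *m (tc *: Q)).
  by rewrite resolvent_adj -scalemxAr -scalemxAl scalerA -expr2 mxtraceZ.
rewrite addrA lerDr.
exact: addr_ge0 (addr_ge0 (mxtrace_mul_adj_ge0 _) e1) e2.
Qed.

Lemma gram_unit : F *m F^*m + tc%:M \in unitmx.
Proof. by have := reg_unit F^*m; rewrite adjmxK. Qed.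

(** Push-through identity: F (F^* F + t) = (F F^* + t) F moves the p x p resolvent to the n x n
    side. *)
Lemma invmx_gram :
  tc *: invmx (F *m F^*m + tc%:M) = 1%:M - F *m Q *m F^*m.
Proof.
have e : (F *m F^*m + tc%:M) *m (1%:M - F *m Q *m F^*m) = tc%:M.
  have e1 : F *m (F^*m *m F + tc%:M) = (F *m F^*m + tc%:M) *m F.
    by rewrite mulmxDl mulmxDr mul_mx_scalar mul_scalar_mx mulmxA.
  rewrite mulmxBr mulmx1 !mulmxA -e1 -(mulmxA F) resolventMr mulmx1.
  by rewrite addrC addKr.
move: e => /(congr1 (mulmx (invmx (F *m F^*m + tc%:M)))).
by rewrite mulmxA mulVmx ?gram_unit// mul1mx mul_mx_scalar => ->.
Qed.

(** F F^* and F^* F have the same nonzero eigenvalues, so their resolvent traces differ by (p - n) /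
    t. *)
Lemma mxtrace_gram_resolvent :
  tc * \tr (invmx (F *m F^*m + tc%:M)) = tc * \tr Q + p%:R - n%:R.
Proof.
rewrite -mxtraceZ invmx_gram raddfB /= mxtrace1.
have -> : \tr (F *m Q *m F^*m) = n%:R - tc * \tr Q.
  rewrite mxtrace_mulC mulmxA; have := resolventMr; rewrite mulmxDl => /eqP.
  rewrite eq_sym -subr_eq => /eqP <-.
  by rewrite mul_scalar_mx raddfB /= mxtrace1 mxtraceZ.
by ring.
Qed.

Lemma mxtrace_gram_sum :
  tc * \tr (invmx (F *m F^*m + tc%:M)) =
  \sum_i (1 - (row i F *m Q *m (row i F)^*m) 0 0).
Proof.
rewrite -mxtraceZ invmx_gram; apply: eq_bigr => i _.
rewrite !mxE eqxx; congr (_ - _); apply: eq_bigr => j _.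
by rewrite !mxE; congr (_ * _); apply: eq_bigr => k _; rewrite !mxE.
Qed.

End Res.
End Fixed.
End Resolvent.

(** * Rank-one updates and the spectrum of a Gram matrix *)

Section RankOne.
Variables (R : realType) (t : R).
Hypothesis t0 : 0 < t.
Local Notation C := (R[i]).
Local Notation tc := (t%:C%C).

Section Update.
Variables (p n : nat) (F F0 : 'M[C]_(p, n)) (s : 'rV[C]_n).
Hypothesis FE : F^*m *m F = F0^*m *m F0 + s^*m *m s.
Local Notation Q := (resolvent t F).
Local Notation Q0 := (resolvent t F0).
Local Notation q := ((s *m Q0 *m s^*m) 0 0).

Let tc0 : 0 < tc :> C. Proof. by rewrite ltcR. Qed.

(** The resolvent identity Q0 (M - M0) Q, where M - M0 is the rank-one matrix s^* s. *)
Lemma resolvent_diff : Q0 - Q = Q0 *m s^*m *m s *m Q.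
Proof.
have -> : Q0 *m s^*m *m s *m Q =
    Q0 *m ((F^*m *m F + tc%:M) - (F0^*m *m F0 + tc%:M)) *m Q.
  by rewrite FE [F0^*m *m F0 + _]addrC -(addrA (s^*m *m s)) addrK !mulmxA.
by rewrite mulmxBr mulmxBl -mulmxA resolventMr// resolventM// mulmx1 mul1mx.
Qed.

Let q0 : 0 <= q. Proof. exact: resolvent_form_ge0. Qed.
Let q1 : 1 + q != 0. Proof. by rewrite gt_eqF// ltr_pwDl. Qed.

(** Sherman-Morrison along s: multiplying [resolvent_diff] by s on the left gives s Q0 - s Q = q (s
    Q). *)
Lemma resolvent_row : s *m Q = (1 + q)^-1 *: (s *m Q0).
Proof.
have e : s *m Q0 = (1 + q) *: (s *m Q).
  have /eqP := congr1 (mulmx s) resolvent_diff.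
  rewrite mulmxBr subr_eq => /eqP e; rewrite [LHS]e.
  rewrite !mulmxA scalerDl scale1r addrC; congr (_ + _).
  by rewrite -mul_scalar_mx -mx11_scalar !mulmxA.
by apply: (canRL (scalerK q1)).
Qed.

Lemma resolvent_form_update : 1 - (s *m Q *m s^*m) 0 0 = (1 + q)^-1.
Proof.
rewrite resolvent_row -scalemxAl mxE; apply: (mulfI q1).
by rewrite mulrBr mulrA mulfV// mulr1 mul1r addrK.
Qed.

Lemma mxtrace_resolvent_update :
  \tr Q0 - \tr Q = (1 + q)^-1 * (s *m Q0 *m Q0 *m s^*m) 0 0.
Proof.
rewrite -raddfB /= resolvent_diff -!mulmxA resolvent_row mulmxA mxtrace_mulC.
by rewrite -scalemxAl mxtraceZ trace_mx11 !mulmxA.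
Qed.

(** The change of trace is s Q0^2 s^* / (1 + q), while t s Q0^2 s^* <= q by [resolvent_form_ge]. *)
Lemma mxtrace_resolvent_mono :
  0 <= tc * (\tr Q0 - \tr Q) <= 1.
Proof.
have q1p : 0 < 1 + q by rewrite ltr_pwDl.
rewrite mxtrace_resolvent_update; apply/andP; split.
  apply: (mulr_ge0 (ltW tc0)); apply: mulr_ge0; last exact: resolvent_sqr_ge0.
  by rewrite invr_ge0 (ltW q1p).
rewrite mulrCA -ler_pdivlMl ?invr_gt0// invrK mulr1.
by apply: le_trans (resolvent_form_ge t0 F0 s) _; rewrite lerDr.
Qed.

End Update.
End RankOne.

(** * Resolvent traces as sums over the spectrum *)

Section Diagonalizable.
Variables (C : fieldType) (p : nat) (A P : 'M[C]_p) (D : 'rV[C]_p).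
Hypotheses (uP : P \in unitmx) (AE : A = invmx P *m diag_mx D *m P).

(** Over the polynomial ring, the characteristic matrix of A is conjugate to that of the diagonal
    matrix. *)
Lemma char_poly_diagonalized : char_poly A = \prod_i ('X - (D 0 i)%:P).
Proof.
have -> : char_poly A = char_poly (diag_mx D).
  rewrite /char_poly /char_poly_mx AE.
  pose PX := map_mx (@polyC C) P; pose PY := map_mx (@polyC C) (invmx P).
  have YX : PY *m PX = 1%:M by rewrite /PX /PY -map_mxM (mulVmx uP) map_mx1.
  have -> : 'X%:M - map_mx polyC (invmx P *m diag_mx D *m P) =
            PY *m ('X%:M - map_mx polyC (diag_mx D)) *m PX.
    rewrite mulmxBr mulmxBl !map_mxM; congr (_ - _).
    by rewrite mul_mx_scalar -scalemxAl YX scalemx1.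
  by rewrite !det_mulmx mulrAC -det_mulmx YX det1 mul1r.
rewrite (char_poly_trig (diag_mx_is_trig D)); apply: eq_bigr => i _.
by rewrite !mxE eqxx.
Qed.

Lemma mxtrace_inv_diagonalized (t : C) : A + t%:M \in unitmx ->
  \tr (invmx (A + t%:M)) = \sum_i (D 0 i + t)^-1.
Proof.
move=> uA; pose E := \row_i (D 0 i + t); pose E' := \row_i (D 0 i + t)^-1.
have e : A + t%:M = invmx P *m diag_mx E *m P.
  have -> : diag_mx E = diag_mx D + t%:M.
    by apply/matrixP => i j; rewrite !mxE mulrnDl.
  rewrite mulmxDr mulmxDl -AE; congr (_ + _).
  by rewrite mul_mx_scalar -scalemxAl (mulVmx uP) scalemx1.
(* Invertibility of A + t passes to the diagonal factor, hence to its determinant and to each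
   entry. *)
have En0 i : D 0 i + t != 0.
  have : diag_mx E \in unitmx.
    by move: uA; rewrite e !unitmx_mul uP andbT unitmx_inv uP.
  rewrite unitmxE det_diag unitfE => /prodf_neq0/(_ i isT).
  by rewrite mxE.
have EE' : diag_mx E *m diag_mx E' = 1%:M.
  rewrite mulmx_diag; apply/matrixP => i j; rewrite !mxE.
  by case: eqP => [->|_]; rewrite ?mulr0n ?(mulfV (En0 _)).
have eI : (A + t%:M) *m (invmx P *m diag_mx E' *m P) = 1%:M.
  by rewrite e !mulmxA (mulmxK uP) -(mulmxA (invmx P)) EE' mulmx1 (mulVmx uP).
have -> : invmx (A + t%:M) = invmx P *m diag_mx E' *m P.
  by have := congr1 (mulmx (invmx (A + t%:M))) eI; rewrite (mulKmx uA) mulmx1.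
rewrite mxtrace_mulC mulmxA (mulmxV uP) mul1mx mxtrace_diag.
by apply: eq_bigr => i _; rewrite mxE.
Qed.

End Diagonalizable.

(** The list [rs] is an arbitrary listing of the roots; unique factorization matches it, up to a
    permutation, with the diagonal given by the spectral theorem. *)
Lemma mxtrace_inv_spectrum (C : numClosedFieldType) (p : nat) (A : 'M[C]_p)
    (rs : seq C) (t : C) :
  A \is normalmx -> char_poly A = \prod_(r <- rs) ('X - r%:P) ->
  A + t%:M \in unitmx ->
  \tr (invmx (A + t%:M)) = \sum_(r <- rs) (r + t)^-1.
Proof.
move=> /orthomx_spectralP.
move: (spectral_unit A) (spectral_diag A); move: (spectralmx A) => P uP D AE Ars uA.
have pE : perm_eq rs [seq D 0 i | i <- enum 'I_p].
  apply: prod_XsubC_eq; rewrite -Ars (char_poly_diagonalized uP AE).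
  by rewrite big_map big_enum.
by rewrite (perm_big _ pE) big_map big_enum (mxtrace_inv_diagonalized uP AE uA).
Qed.

Section GramSpectrum.
Variable R : realType.
Local Notation C := (R[i]).

(** An eigenvector v gives r |v|^2 = |v F|^2 with |v|^2 > 0. *)
Lemma gram_eigenvalue_ge0 (p n : nat) (F : 'M[C]_(p, n)) (r : C) :
  root (char_poly (F *m F^*m)) r -> 0 <= r.
Proof.
rewrite -eigenvalue_root_char => /eigenvalueP[v vE v0].
have : 0 <= ((v *m F) *m (v *m F)^*m) 0 0 by exact: mul_adj11_ge0.
rewrite adjmxM !mulmxA -(mulmxA v) vE -scalemxAl mxE.
rewrite pmulr_lge0// lt_neqAle mul_adj11_ge0 andbT eq_sym.
by apply: contra_neq v0; exact: mul_adj_eq0.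
Qed.

Lemma gram_normalmx (p n : nat) (F : 'M[C]_(p, n)) : F *m F^*m \is normalmx.
Proof.
have e : (F *m F^*m)^*m = F *m F^*m by rewrite adjmxM adjmxK.
by apply/normalmxP; move: e; rewrite /adjmx -map_trmx => ->.
Qed.

End GramSpectrum.

(** * Mutually unbiased bases *)

Section Bessel.
Variable R : realType.
Local Notation C := (R[i]).
Variables (n m : nat) (B : 'I_m -> 'M[C]_n).
Hypotheses (n_gt0 : (0 < n)%N) (mub : mutually_unbiased B).

Definition pool (v : 'I_m * 'I_n) : 'rV[C]_n := row v.2 (B v.1).

Lemma hdotE (k : nat) (u v : 'rV[C]_k) : hdot u v = (u *m v^*m) 0 0.
Proof. by rewrite mxE; apply: eq_bigr => i _; rewrite adjmxE. Qed.

Lemma hdot_pool v w : `|hdot (pool v) (pool w)| ^+ 2 =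
  if v.1 == w.1 then (v.2 == w.2)%:R else n%:R^-1.
Proof.
case: mub => onb unb; case: (v.1 =P w.1) => [vw|/eqP vw].
  rewrite /pool vw onb; case: (_ == _); first by rewrite normr1 expr1n.
  by rewrite normr0 expr0n.
rewrite unb// exprVn sqrtCK//.
Qed.

Lemma mub_unitary i : (B i)^*m *m B i = 1%:M.
Proof.
apply: mulmx1C; apply/matrixP => a b; case: mub => /(_ i) /(_ a b) + _.
by rewrite hdotE !mxE => <-; apply: eq_bigr => k _; rewrite !mxE.
Qed.

Variable Q : 'M[C]_n.

Definition form (b : 'rV[C]_n) : C := (b *m Q *m b^*m) 0 0.
Let x v := form (pool v) - \tr Q / n%:R.

Lemma sum_form_basis i : \sum_a form (pool (i, a)) = \tr Q.
Proof.
have -> : \tr Q = \tr (B i *m Q *m (B i)^*m).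
  by rewrite mxtrace_mulC mulmxA mub_unitary mul1mx.
apply: eq_bigr => a _; rewrite /form /pool !mxE; apply: eq_bigr => k _.
by rewrite !mxE; congr (_ * _); apply: eq_bigr => l _; rewrite !mxE.
Qed.

Lemma sum_centered_form i : \sum_a x (i, a) = 0.
Proof.
rewrite sumrB sum_form_basis sumr_const card_ord -[_ / _ *+ _]mulr_natr divfK ?subrr//.
by rewrite pnatr_eq0 -lt0n.
Qed.

(* Distinct bases give orthogonal spaces of traceless diagonal matrices, so
   the Gram matrix of the projectors acts on centered vectors as the identity. *)
Lemma sum_weight v : \sum_w (x w)^* * `|hdot (pool v) (pool w)| ^+ 2 = (x v)^*.
Proof.
rewrite -(pair_bigA _ (fun i a => (x (i, a))^* * `|hdot (pool v) (pool (i, a))| ^+ 2)) /=.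
rewrite (bigD1 v.1)//= [X in _ + X]big1 ?addr0 => [|i /negPf iv].
  rewrite (bigD1 v.2)//= [X in _ + X]big1 ?addr0 => [|a /negPf av].
    by rewrite hdot_pool /= !eqxx mulr1; case: v.
  by rewrite hdot_pool /= eqxx eq_sym av mulr0.
transitivity (\sum_a (x (i, a))^* * n%:R^-1).
  by apply: eq_bigr => a _; rewrite hdot_pool /= eq_sym iv.
by rewrite -mulr_suml -rmorph_sum /= sum_centered_form rmorph0 mul0r.
Qed.

Lemma mxtrace_proj (b : 'rV[C]_n) (A : 'M[C]_n) :
  \tr (A *m (b^*m *m b)) = (b *m A *m b^*m) 0 0.
Proof. by rewrite mulmxA mxtrace_mulC trace_mx11 !mulmxA. Qed.

Lemma mxtrace_rank1 (u w : 'rV[C]_n) :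
  \tr (u^*m *m u *m (w^*m *m w)) = `|hdot u w| ^+ 2.
Proof.
rewrite mxtrace_proj !mulmxA -mulmxA mxE big_ord1 normCKC hdotE -adjmxE.
by rewrite adjmxM adjmxK.
Qed.

(** With Y the combination of the projectors weighted by x, the products <Q, Y>, <Y, Q> and <Y, Y>
    all equal the sum of |x_v|^2, so 0 <= |Q - Y|^2 is the claim. *)
Lemma mub_bessel : \sum_v `|x v| ^+ 2 <= \tr (Q *m Q^*m).
Proof.
pose E v := (pool v)^*m *m pool v.
pose Y := \sum_v x v *: E v.
have EA v : (E v)^*m = E v by rewrite /E adjmxM adjmxK.
have YA : Y^*m = \sum_v (x v)^* *: E v.
  rewrite /Y /adjmx linear_sum /= map_mx_sum; apply: eq_bigr => v _.
  by rewrite linearZ /= map_mxZ -[in RHS](EA v).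
have x0 : \sum_v x v = 0.
  rewrite -(pair_bigA _ (fun i a => x (i, a))) /= big1// => i _.
  exact: sum_centered_form.
(* The constant tr Q / n separating the form from x drops out because the x_v sum to zero. *)
have eQY : \tr (Q *m Y^*m) = \sum_v `|x v| ^+ 2.
  rewrite YA mulmx_sumr linear_sum /=.
  transitivity (\sum_v ((x v)^* * x v + (\tr Q / n%:R) * (x v)^*)).
    apply: eq_bigr => v _; rewrite -scalemxAr mxtraceZ mxtrace_proj.
    by rewrite -/(form _) [\tr Q / _ * _]mulrC -mulrDr /x subrK.
  rewrite big_split /= -mulr_sumr -rmorph_sum /= x0 rmorph0 mulr0 addr0.
  by apply: eq_bigr => v _; rewrite normCKC.
have trA (A : 'M[C]_n) : \tr A^*m = (\tr A)^*.
  by rewrite rmorph_sum /=; apply: eq_bigr => i _; rewrite adjmxE.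
have eYQ : \tr (Y *m Q^*m) = \sum_v `|x v| ^+ 2.
  rewrite -(adjmxK Y) -adjmxM trA eQY rmorph_sum /=.
  by apply: eq_bigr => v _; rewrite rmorphXn /= conj_normC.
have eYY : \tr (Y *m Y^*m) = \sum_v `|x v| ^+ 2.
  rewrite {1}/Y mulmx_suml linear_sum /=; apply: eq_bigr => v _.
  rewrite -scalemxAl mxtraceZ normCK -(sum_weight v) YA mulmx_sumr linear_sum /=.
  congr (_ * _); apply: eq_bigr => w _; rewrite -scalemxAr mxtraceZ.
  by congr (_ * _); exact: mxtrace_rank1.
have := mxtrace_mul_adj_ge0 (Q - Y).
have -> : (Q - Y)^*m = Q^*m - Y^*m.
  by rewrite /adjmx linearB /= map_mxB.
rewrite mulmxBl !mulmxBr !raddfB /= eQY eYQ eYY subrr addr0.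
by rewrite subr_ge0.
Qed.

End Bessel.

(** * Independence of one draw from the others *)

Section Resample.
Variables (K : fieldType) (T : finType) (p : nat).

Definition upd (s : {ffun 'I_p -> T}) (i : 'I_p) (v : T) : {ffun 'I_p -> T} :=
  [ffun j => if j == i then v else s j].

(** Exchanging the i-th draw with a fresh one is an involution on pairs (s, v). If H ignores the
    i-th draw of its first argument, the average over s therefore equals the average over
    independent s and v. *)
Lemma sum_resample (H : {ffun 'I_p -> T} -> T -> K) (i : 'I_p) :
  (forall s v w, H (upd s i v) w = H s w) ->
  #|T|%:R * \sum_s H s (s i) = \sum_s \sum_v H s v.
Proof.
move=> Hupd; pose h (sv : {ffun 'I_p -> T} * T) := (upd sv.1 i sv.2, sv.1 i).
have hK : involutive h.
  move=> [s v]; rewrite /h /=; congr (_, _); last by rewrite ffunE eqxx.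
  by apply/ffunP => j; rewrite !ffunE; case: eqP => // ->.
rewrite pair_bigA (reindex_inj (inv_inj hK)) /=.
rewrite (eq_bigr (fun sv => H sv.1 (sv.1 i))); last by move=> sv _; rewrite Hupd.
rewrite -(pair_bigA _ (fun s _ => H s (s i))) /= mulr_sumr.
by apply: eq_bigr => s _; rewrite sumr_const mulr_natl.
Qed.

End Resample.

(** * Leave-one-out analysis of the random Gram matrix *)

Section Gram.
Variables (R : realType) (n m p : nat).
Local Notation re := (@complex.Re R).
Local Notation C := (R[i]).
Variable B : 'I_m -> 'M[C]_n.
Implicit Type s : {ffun 'I_p -> 'I_m * 'I_n}.

(** Real parts lose nothing here, a Gram matrix having real nonnegative eigenvalues. *)
Definition spectrum s : seq R := map re (eigenvalues (gram_of B s)).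

Lemma char_poly_eigenvalues (k : nat) (A : 'M[C]_k) :
  char_poly A = \prod_(r <- eigenvalues A) ('X - r%:P).
Proof. by apply/eqP; exact: (xchooseP (char_poly_splits A)). Qed.

Lemma size_spectrum s : size (spectrum s) = p.
Proof.
rewrite size_map; apply: succn_inj.
by rewrite -(size_prod_XsubC _ id) -char_poly_eigenvalues size_char_poly.
Qed.

Lemma eigenvalue_gram s r : r \in eigenvalues (gram_of B s) ->
  r = (re r)%:C%C /\ 0 <= re r.
Proof.
move=> rG; have : 0 <= r.
  apply: (@gram_eigenvalue_ge0 R p n (Phi_of B s)).
  by rewrite -/(gram_of B s) char_poly_eigenvalues root_prod_XsubC.
by case: r {rG} => a b; rewrite lecE /= => /andP[/eqP -> ->].
Qed.

Lemma spectrum_ge0 s r : r \in spectrum s -> 0 <= r.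
Proof. by move=> /mapP[z /eigenvalue_gram[_ z0] ->]. Qed.

(** The order on complex numbers also requires equal imaginary parts; the eigenvalues being real, it
    reduces to the real order. *)
Lemma esd_spectrum s x :
  esd (gram_of B s) x = (count (fun r => r <= x) (spectrum s))%:R / p%:R.
Proof.
rewrite /esd /spectrum count_map; congr (_%:R / _); apply: eq_in_count => r rG.
by rewrite /= {1}(eigenvalue_gram rG).1 lecR.
Qed.

Section Stieltjes.
Variable t : R.
Hypothesis t0 : 0 < t.

(** The row is set to zero rather than removed: F^* F is the same, and the dimensions and indices do
    not change. *)
Definition drop_row s (i : 'I_p) : 'M[C]_(p, n) :=
  \matrix_(j, k) (if j == i then 0 else Phi_of B s j k).

Lemma Phi_drop_row s i : (Phi_of B s)^*m *m Phi_of B s =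
  (drop_row s i)^*m *m drop_row s i + (pool B (s i))^*m *m pool B (s i).
Proof.
apply/matrixP => k l; rewrite mxE [RHS]mxE [X in X + _]mxE [X in _ + X]mxE.
rewrite big_ord1 (bigD1 i)//= addrC; congr (_ + _); last by rewrite !mxE.
rewrite [RHS](bigD1 i)//= [drop_row s i i l]mxE eqxx mulr0 add0r.
by apply: eq_bigr => j /negPf ji; rewrite !mxE ji.
Qed.

(** This is the form taken by the independence of Q_i and s_i: it supplies the hypothesis of
    [sum_resample]. *)
Lemma drop_row_upd s i v : drop_row (upd s i v) i = drop_row s i.
Proof.
apply/matrixP => j k; rewrite !mxE; case: eqP => // /eqP/negPf ji.
by rewrite !ffunE ji.
Qed.

Let Q s := resolvent t (Phi_of B s).
Let Q0 s i := resolvent t (drop_row s i).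

(** These three definitions are q_i, tr Q_i / n and tr Q / n. The complex quantities are
    nonnegative, so real parts lose nothing. *)
Definition cavity s i : R := re (form (Q0 s i) (pool B (s i))).
Definition cavity_mean s i : R := re (\tr (Q0 s i)) / n%:R.
Definition mean_resolvent s : R := re (\tr (Q s)) / n%:R.

Lemma nneg_ReE (z : C) : 0 <= z -> z = (re z)%:C%C.
Proof. by case: z => a b; rewrite lecE /= => /andP[/eqP -> _]. Qed.

Lemma nneg_Re_ge0 (z : C) : 0 <= z -> 0 <= re z.
Proof. by case: z => a b; rewrite lecE /= => /andP[_ ->]. Qed.

Lemma nneg_Re_diff (a b : C) : 0 <= a -> 0 <= b ->
  0 <= t%:C%C * (b - a) <= 1 -> 0 <= t * (re b - re a) <= 1.
Proof.
move=> /nneg_ReE -> /nneg_ReE ->.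
by rewrite -rmorphB -rmorphM -[0]/(0%:C%C) -[1]/(1%:C%C) !lecR.
Qed.

Lemma cavity_ge0 s i : 0 <= cavity s i.
Proof. by apply: nneg_Re_ge0; exact: resolvent_form_ge0. Qed.

Lemma mean_resolvent_ge0 s : 0 <= mean_resolvent s.
Proof.
by rewrite divr_ge0// nneg_Re_ge0//; exact: mxtrace_resolvent_ge0.
Qed.

Lemma row_Phi s i : row i (Phi_of B s) = pool B (s i).
Proof. by apply/rowP => k; rewrite !mxE. Qed.


Lemma mxtrace_gram_cavity s :
  t%:C%C * \tr (invmx (gram_of B s + t%:C%C%:M)) =
  (\sum_i (1 + cavity s i)^-1)%:C%C.
Proof.
rewrite /gram_of mxtrace_gram_sum// rmorph_sum /=; apply: eq_bigr => i _.
rewrite row_Phi (resolvent_form_update t0 (Phi_drop_row s i)).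
have /nneg_ReE := resolvent_form_ge0 t0 (drop_row s i) (pool B (s i)).
by rewrite -/(form _ _) => ->; rewrite rmorphV ?unitfE ?gt_eqF ?ltr_pwDl ?cavity_ge0// rmorphD rmorph1.
Qed.

(** Up to the factor p, the sum on the left is the Stieltjes transform of the empirical spectral
    distribution at -t. *)
Lemma spectrum_cavity s :
  t * \sum_(r <- spectrum s) (r + t)^-1 = \sum_i (1 + cavity s i)^-1.
Proof.
apply: (@complexI R); rewrite -mxtrace_gram_cavity rmorphM; congr (_ * _).
rewrite (mxtrace_inv_spectrum (gram_normalmx _) (char_poly_eigenvalues _)); last first.
  exact: gram_unit.
rewrite /spectrum big_map rmorph_sum /=; apply: eq_big_seq => r rG.
have [rE r0] := eigenvalue_gram rG.
by rewrite [in RHS]rE rmorphV ?unitfE ?gt_eqF ?ltr_wpDl// rmorphD.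
Qed.

(** Still exact; replacing every q_i by g = tr Q / n would turn it into t g = 1 - y + y / (1 +
    g). *)
Lemma mean_resolvent_cavity s : (0 < n)%N ->
  t * mean_resolvent s =
  1 - p%:R / n%:R + (\sum_i (1 + cavity s i)^-1) / n%:R.
Proof.
move=> n0; have nn : n%:R != 0 :> R by rewrite pnatr_eq0 -lt0n.
have := mxtrace_gram_cavity s; rewrite mxtrace_gram_resolvent//.
rewrite (nneg_ReE (mxtrace_resolvent_ge0 t0 _)) => e.
have {}e : t * re (\tr (Q s)) + p%:R - n%:R = \sum_i (1 + cavity s i)^-1.
  by apply: (@complexI R); rewrite -e rmorphB rmorphD rmorphM !rmorph_nat.
by rewrite -e /mean_resolvent; field.
Qed.

Lemma cavity_mean_close s i : (0 < n)%N ->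
  `|cavity_mean s i - mean_resolvent s| <= (t * n%:R)^-1.
Proof.
move=> n0; have nn : 0 < n%:R :> R by rewrite ltr0n.
have := mxtrace_resolvent_mono t0 (Phi_drop_row s i).
move=> /(nneg_Re_diff (mxtrace_resolvent_ge0 t0 _) (mxtrace_resolvent_ge0 t0 _)).
move=> /andP[h0 h1].
rewrite /cavity_mean /mean_resolvent -mulrBl normrM (ger0_norm (ltW _ : 0 <= n%:R^-1)) ?invr_gt0//.
rewrite ger0_norm; last by move: h0; rewrite pmulr_rge0.
by rewrite ler_pdivrMr// invfM -mulrA mulVf ?gt_eqF// mulr1 -[t^-1]mulr1 ler_pdivlMl.
Qed.

Hypotheses (n_gt0 : (0 < n)%N) (mub : mutually_unbiased B).

(** Chains [mub_bessel] with the Hilbert-Schmidt bound [resolvent_HS]. *)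
Lemma pool_variance s i :
  \sum_v (re (form (Q0 s i) (pool B v)) - cavity_mean s i) ^+ 2 <= n%:R / t ^+ 2.
Proof.
rewrite ler_pdivlMr ?exprn_gt0// mulrC -lecR [X in _ <= X]rmorph_nat.
apply: le_trans (resolvent_HS t0 (drop_row s i)).
rewrite rmorphM rmorphXn ler_pM2l ?exprn_gt0 ?ltcR//.
apply: le_trans (mub_bessel n_gt0 mub _).
rewrite rmorph_sum le_eqVlt; apply/orP; left; apply/eqP; apply: eq_bigr => v _.
rewrite (nneg_ReE (mxtrace_resolvent_ge0 t0 _)).
rewrite [form _ _](nneg_ReE (resolvent_form_ge0 t0 _ _)).
rewrite -(rmorph_nat (real_complex R)) -fmorph_div -rmorphB -normrX.
by rewrite -rmorphXn ger0_norm// lecR sqr_ge0.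
Qed.

(** Resampling the i-th draw replaces s_i by a uniform vector of the pool, so the variance bound n /
    t^2 is divided by the pool size m n. *)
Lemma mean_cavity_variance i : (0 < m)%N ->
  \sum_s (cavity s i - cavity_mean s i) ^+ 2 <=
  ((m * n) ^ p)%:R * (m%:R * t ^+ 2)^-1.
Proof.
move=> m_gt0.
pose H s v := (re (form (Q0 s i) (pool B v)) - cavity_mean s i) ^+ 2.
have HU s v w : H (upd s i v) w = H s w.
  by rewrite /H /cavity_mean /Q0 drop_row_upd.
have := sum_resample HU; rewrite /H => e.
have T0 : 0 < #|{: 'I_m * 'I_n}|%:R :> R.
  by rewrite ltr0n card_prod !card_ord muln_gt0 m_gt0.
rewrite -(ler_pM2l T0) e.
apply: le_trans (ler_sum _ (fun s _ => pool_variance s i)) _.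
rewrite sumr_const -[_ *+ _]mulr_natl card_ffun card_prod !card_ord.
rewrite natrM le_eqVlt; apply/orP; left; apply/eqP.
by field; rewrite !pnatr_eq0 -!lt0n m_gt0 gt_eqF.
Qed.

End Stieltjes.
End Gram.

(** * The self-consistent equation *)

Section ScalarEstimates.
Variable R : realFieldType.

Lemma inv1D_lipschitz (a b : R) : 0 <= a -> 0 <= b ->
  `|(1 + a)^-1 - (1 + b)^-1| <= `|a - b|.
Proof.
move=> a0 b0; have -> : (1 + a)^-1 - (1 + b)^-1 = (b - a) / ((1 + a) * (1 + b)).
  by field; rewrite !gt_eqF//; lra.
rewrite normrM distrC ler_piMr// normfV ger0_norm ?invf_le1 //; nra.
Qed.


(** Since t g increases and y / (1 + g) decreases in g, the two differences have opposite signs and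
    cannot cancel the error: t |g - gs| is at most D, for every t. *)
Lemma mp_fixpoint_stable (t y g gs u D : R) : 0 <= y -> 0 <= g -> 0 <= gs ->
  t * g = 1 - y + u -> t * gs = 1 - y + y / (1 + gs) ->
  `|u - y / (1 + g)| <= D -> t * `|g - gs| <= D.
Proof.
move=> y0 g0 gs0 eg egs; rewrite ler_norml => /andP[h1 h2].
case: (leP gs g) => ggs.
  have : y / (1 + g) <= y / (1 + gs) by rewrite ler_wpM2l// lef_pV2 ?posrE; lra.
  by rewrite ger0_norm ?subr_ge0//; lra.
have : y / (1 + gs) <= y / (1 + g) by rewrite ler_wpM2l// lef_pV2 ?posrE; lra.
by rewrite ltr0_norm ?subr_lt0//; lra.
Qed.

(** Takes the place of Cauchy-Schwarz: a mean-square bound becomes a mean absolute bound, with d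
    left free to be optimized. *)
Lemma norm_le_sqr (x d : R) : 0 < d -> `|x| <= d + x ^+ 2 / d.
Proof.
move=> d0; case: (leP `|x| d) => xd; first by rewrite ler_wpDr// divr_ge0 ?sqr_ge0 ?ltW.
rewrite ler_wpDl ?(ltW d0)// ler_pdivlMr// -real_normK ?num_real// expr2.
by rewrite ler_wpM2l// ltW.
Qed.

End ScalarEstimates.

(** * Mean deviation of the Stieltjes transform *)

Section MeanStieltjes.
Variables (R : realType) (n m p : nat) (B : 'I_m -> 'M[R[i]]_n) (t y gs : R).
Hypotheses (n_gt0 : (0 < n)%N) (m_gt0 : (0 < m)%N) (p_gt0 : (0 < p)%N).
Hypotheses (mub : mutually_unbiased B) (t0 : 0 < t) (yE : p%:R / n%:R = y).
Hypotheses (gs0 : 0 <= gs) (gsE : t * gs = 1 - y + y / (1 + gs)).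
Implicit Type s : {ffun 'I_p -> 'I_m * 'I_n}.

Let nn : 0 < n%:R :> R. Proof. by rewrite ltr0n. Qed.
Let pp : 0 < p%:R :> R. Proof. by rewrite ltr0n. Qed.
Let y0 : 0 < y. Proof. by rewrite -yE divr_gt0. Qed.

Let x s i := cavity B t s i - cavity_mean B t s i.

(** Both transforms are the same affine function, of g and of gs, so they differ by (g - gs) / y.
    Stability reduces this to the average distance between q_i and g, split at tr Q_i / n. *)
Lemma stieltjes_dev s :
  `|(\sum_(r <- spectrum B s) (r + t)^-1) / p%:R - (gs - (1 - y) / t) / y| <=
  (y * t * n%:R)^-1 * \sum_i (`|x s i| + (t * n%:R)^-1).
Proof.
pose g := mean_resolvent B t s; pose U := \sum_i (1 + cavity B t s i)^-1.
have gE : t * g = 1 - y + U / n%:R.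
  by rewrite -yE; exact: mean_resolvent_cavity.
have g0 : 0 <= g by exact: mean_resolvent_ge0.
have LE : (\sum_(r <- spectrum B s) (r + t)^-1) / p%:R = (g - (1 - y) / t) / y.
  have uE := spectrum_cavity B t0 s; rewrite -/U in uE.
  have {}gE : g = (1 - y) / t + U / n%:R / t.
    by rewrite -mulrDl -gE mulrC mulKf ?gt_eqF.
  rewrite gE addrC addKr -uE -yE; field.
  by rewrite !gt_eqF.
have -> : (\sum_(r <- spectrum B s) (r + t)^-1) / p%:R - (gs - (1 - y) / t) / y =
    (g - gs) * y^-1 by rewrite LE; ring.
rewrite normrM (gtr0_norm (_ : 0 < y^-1)) ?invr_gt0//.
have : t * `|g - gs| <= n%:R^-1 * \sum_i (`|x s i| + (t * n%:R)^-1).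
  apply: (mp_fixpoint_stable (ltW y0) g0 gs0 gE gsE).
  have -> : U / n%:R - y / (1 + g) =
      n%:R^-1 * \sum_i ((1 + cavity B t s i)^-1 - (1 + g)^-1).
    rewrite sumrB sumr_const card_ord -/U -yE -[_^-1 *+ _]mulr_natl; field.
    by rewrite !gt_eqF// ltr_pwDl.
  rewrite normrM (gtr0_norm (_ : 0 < n%:R^-1)) ?invr_gt0// ler_pM2l ?invr_gt0//.
  apply: le_trans (ler_norm_sum _ _ _) _; apply: ler_sum => i _.
  apply: le_trans (inv1D_lipschitz (cavity_ge0 B t0 s i) g0) _.
  have := cavity_mean_close B t0 s i n_gt0; rewrite -/g => h.
  apply: le_trans (_ : `|x s i| + `|cavity_mean B t s i - g| <= _); last by rewrite lerD2l.
  by apply: le_trans (ler_normD _ _); rewrite /x addrA subrK.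
rewrite -ler_pdivlMl// => h.
rewrite ler_pdivrMr//; apply: le_trans h _.
rewrite le_eqVlt; apply/orP; left; apply/eqP.
by field; rewrite !gt_eqF.
Qed.

(** Averages [stieltjes_dev] over all draws, with [norm_le_sqr] applied at d to the variance 1 / (m
    t^2); the factor p / (y t n) is 1 / t. *)
Lemma mean_stieltjes_dev (d : R) : 0 < d ->
  (\sum_(s : {ffun 'I_p -> 'I_m * 'I_n}) `|(\sum_(r <- spectrum B s) (r + t)^-1) / p%:R - (gs - (1 - y) / t) / y|)
    / ((m * n) ^ p)%:R <=
  t^-1 * (d + (d * (m%:R * t ^+ 2))^-1) + (t ^+ 2 * n%:R)^-1.
Proof.
move=> d0; pose N : R := ((m * n) ^ p)%:R.
have N0 : 0 < N by rewrite ltr0n expn_gt0 muln_gt0 m_gt0 n_gt0.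
have mm : 0 < m%:R :> R by rewrite ltr0n.
rewrite ler_pdivrMr//.
apply: le_trans (ler_sum _ (fun s _ => stieltjes_dev s)) _.
rewrite -mulr_sumr exchange_big /=.
have h i : \sum_s (`|x s i| + (t * n%:R)^-1) <=
    N * (d + (d * (m%:R * t ^+ 2))^-1 + (t * n%:R)^-1).
  have cN (c : R) : \sum_(s : {ffun 'I_p -> 'I_m * 'I_n}) c = N * c.
    by rewrite sumr_const card_ffun card_prod !card_ord mulr_natl.
  rewrite big_split /= cN mulrDr lerD2r.
  apply: le_trans (ler_sum _ (fun s _ => norm_le_sqr (x s i) d0)) _.
  rewrite big_split /= cN mulrDr lerD2l -mulr_suml ler_pdivrMr//.
  apply: le_trans (mean_cavity_variance t0 n_gt0 mub i m_gt0) _.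
  rewrite le_eqVlt; apply/orP; left; apply/eqP; rewrite -/N.
  by field; rewrite !gt_eqF.
apply: le_trans (_ : (y * t * n%:R)^-1 * (p%:R *
  (N * (d + (d * (m%:R * t ^+ 2))^-1 + (t * n%:R)^-1))) <= _).
  rewrite ler_pM2l ?invr_gt0 ?mulr_gt0//.
  apply: le_trans (ler_sum _ (fun i _ => h i)) _.
  by rewrite sumr_const card_ord [X in _ <= X]mulr_natl.
rewrite le_eqVlt; apply/orP; left; apply/eqP; rewrite -/N -yE.
by field; rewrite !gt_eqF.
Qed.

End MeanStieltjes.

(** * The Marchenko-Pastur law *)

Section MPIntegral.
Variable R : realType.
Local Notation mu := (@lebesgue_measure R).

Lemma is_derive_atan_div (f g : R -> R) (x f' g' : R) : g x != 0 ->
  is_derive x 1 f f' -> is_derive x 1 g g' ->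
  is_derive x 1 (fun z => atan (f z / g z)) ((f' * g x - f x * g') / (g x ^+ 2 + f x ^+ 2)).
Proof.
move=> g0 df dg; have dV := is_deriveV g0 dg.
have dM := is_deriveM df dV.
have D : is_derive x 1 (fun z => atan (f z / g z)) _ :=
  @is_derive1_comp R atan (fun z => f z / g z) x _ _ (is_derive1_atan _) dM.
apply: (is_derive_eq D); rewrite /GRing.scale /=.
have h1 : 0 < g x ^+ 2 + f x ^+ 2.
  by rewrite ltr_wpDr ?sqr_ge0// exprn_even_gt0.
have h2 : 0 < 1 + (f x / g x) ^+ 2 by rewrite ltr_wpDr ?sqr_ge0.
by field; rewrite g0 gt_eqF.
Qed.

(** W and S stand for the square roots, known only through their squares. The denominators factor as
    2 r (r + W) and 2 r (x + c) M, so the arctangent terms collapse to 1 / (2 W) and S / (2 W (x +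
    c)). *)
Lemma mp_primitive_identity (a b c x W S : R) :
  0 < a + c -> a < x < b -> 0 < W -> 0 < S ->
  W ^+ 2 = (b - x) * (x - a) -> S ^+ 2 = (a + c) * (b + c) ->
  let d := (a + b) / 2 in let r := (b - a) / 2 in
  let N := (d + c) * (x + c) - (a + c) * (b + c) in
  let M := r * (x + c) + S * W in
  (d - x) / W + 2 * (d + c) * ((r + W - (x - d) * ((d - x) / W)) /
    ((r + W) ^+ 2 + (x - d) ^+ 2)) -
  2 * S * (((d + c) * M - N * (r + S * ((d - x) / W))) / (M ^+ 2 + N ^+ 2)) =
  W / (x + c).
Proof.
move=> ac /andP[ax xb] W0 S0 W2 S2 d r N M.
have r0 : 0 < r by rewrite /r; lra.
have X0 : 0 < x + c by lra.
have Wn : W != 0 by rewrite gt_eqF.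
have Xn : x + c != 0 by rewrite gt_eqF.
have rn : r != 0 by rewrite gt_eqF.
have rWn : r + W != 0 by rewrite gt_eqF// addr_gt0.
have Mn : M != 0 by rewrite gt_eqF// addr_gt0// mulr_gt0.
have -> : (r + W - (x - d) * ((d - x) / W)) / ((r + W) ^+ 2 + (x - d) ^+ 2) =
    (2 * W)^-1.
  have -> : (r + W) ^+ 2 + (x - d) ^+ 2 = 2 * r * (r + W).
    transitivity (r ^+ 2 + 2 * r * W + W ^+ 2 + (x - d) ^+ 2); first by ring.
    by rewrite W2 /r /d; field.
  have -> : r + W - (x - d) * ((d - x) / W) = r * (r + W) / W.
    transitivity ((r * W + W ^+ 2 + (x - d) ^+ 2) / W); first by field.
    by rewrite W2 /r /d; field.
  by field; rewrite rWn Wn rn.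
have -> : ((d + c) * M - N * (r + S * ((d - x) / W))) / (M ^+ 2 + N ^+ 2) =
    S / (2 * W * (x + c)).
  have -> : M ^+ 2 + N ^+ 2 = 2 * r * (x + c) * M.
    transitivity (r ^+ 2 * (x + c) ^+ 2 + 2 * r * (x + c) * S * W +
      S ^+ 2 * W ^+ 2 + N ^+ 2); first by rewrite /M; ring.
    by rewrite W2 S2 /M /N /r /d; field.
  have -> : (d + c) * M - N * (r + S * ((d - x) / W)) = S * r * M / W.
    transitivity (((a + c) * (b + c) * r * W +
      S * ((d + c) * W ^+ 2 - N * (d - x))) / W); first by rewrite /M /N; field.
    transitivity ((S * r ^+ 2 * (x + c) + r * S ^+ 2 * W) / W); last first.
      by rewrite /M; field.
    by rewrite W2 S2 /N /r /d; field.
  by field; rewrite Mn Xn Wn rn.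
transitivity (((d - x + (d + c)) * (x + c) - S ^+ 2) / (W * (x + c))).
  by field; rewrite Xn Wn.
transitivity (W ^+ 2 / (W * (x + c))); last by field; rewrite Xn Wn.
by rewrite W2 S2 /d; field; rewrite Xn Wn.
Qed.

Section Primitive.
Variables a b c : R.
Hypotheses (ac : 0 < a + c) (ab : a < b).

Definition semicircle (x : R) := Num.sqrt ((b - x) * (x - a)).
Local Notation w := semicircle.
Local Notation r := ((b - a) / 2).
Local Notation d := ((a + b) / 2).
Local Notation s := (Num.sqrt ((a + c) * (b + c))).

Let F1 x := (x - d) / (r + w x).
Let N x := (d + c) * (x + c) - (a + c) * (b + c).
Let M x := r * (x + c) + s * w x.

(* Substituting the half-angle of the circle of diameter [a, b]; the two
   arctangents are half of the usual arcsines, but smooth up to the endpoints. *)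
Definition mp_primitive x :=
  w x + 2 * (d + c) * atan (F1 x) - 2 * s * atan (N x / M x).

Let w_continuous : continuous w.
Proof.
move=> x; apply: (continuous_comp (f := fun x => (b - x) * (x - a))); last exact: sqrt_continuous.
by apply: cvgM; apply: cvgB; [exact: cvg_cst|exact: cvg_id|exact: cvg_id|exact: cvg_cst].
Qed.

Let w_ge0 x : 0 <= w x. Proof. exact: sqrtr_ge0. Qed.
Let r_gt0 : 0 < r. Proof. by move: ab; lra. Qed.
Let s_gt0 : 0 < s. Proof. by rewrite sqrtr_gt0 mulr_gt0//; move: ac ab; lra. Qed.
Let rw_gt0 x : 0 < r + w x. Proof. exact: ltr_wpDr. Qed.
Let M_gt0 x : a <= x -> 0 < M x.
Proof.
move=> ax; apply: ltr_wpDr; first by rewrite mulr_ge0// ltW.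
by rewrite mulr_gt0//; move: ac ax; lra.
Qed.

Lemma mp_primitive_continuous x : a <= x -> {for x, continuous mp_primitive}.
Proof.
move=> ax.
have cst (k : R) : {for x, continuous (fun _ : R => k)} by exact: cvg_cst.
have id_ : {for x, continuous (fun y : R => y)} by exact: cvg_id.
have cw : {for x, continuous w} by exact: w_continuous.
have cF1 : {for x, continuous F1}.
  exact: cvgM (cvgB id_ (cst d)) (cvgV (lt0r_neq0 (rw_gt0 x)) (cvgD (cst r) cw)).
have cNM : {for x, continuous (fun z => N z / M z)}.
  apply: cvgM (cvgB (cvgM (cst _) (cvgD id_ (cst c))) (cst _)) _.
  apply: cvgV (lt0r_neq0 (M_gt0 ax)) _.
  exact: cvgD (cvgM (cst _) (cvgD id_ (cst c))) (cvgM (cst s) cw).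
have cA1 := continuous_comp cF1 (@continuous_atan R _).
have cA2 := continuous_comp cNM (@continuous_atan R _).
exact: cvgB (cvgD cw (cvgM (cst _) cA1)) (cvgM (cst _) cA2).
Qed.

Lemma semicircle_div_continuous x : a <= x -> {for x, continuous (fun x => w x / (x + c))}.
Proof.
move=> ax; apply: cvgM; first exact: w_continuous.
by apply: cvgV; [rewrite gt_eqF//; move: ac ax; lra|apply: cvgD; [exact: cvg_id|exact: cvg_cst]].
Qed.

Lemma mp_primitive_derive x : a < x < b ->
  is_derive x 1 mp_primitive (w x / (x + c)).
Proof.
move=> /andP[ax xb].
have z0 : 0 < (b - x) * (x - a) by rewrite mulr_gt0; lra.
have w0 : 0 < w x by rewrite sqrtr_gt0.
have w2 : w x ^+ 2 = (b - x) * (x - a) by rewrite sqr_sqrtr// ltW.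
have s2 : s ^+ 2 = (a + c) * (b + c) by rewrite sqr_sqrtr// ltW// mulr_gt0//; move: ac ab; lra.
have cst (k : R) : is_derive x 1 (fun _ : R => k) 0 by exact: is_derive_cst.
have iX : is_derive x 1 (fun y : R => y) 1 by exact: is_derive_id.
have dw : is_derive x 1 w ((d - x) / w x).
  have dz := is_deriveM (is_deriveB (cst b) iX) (is_deriveB iX (cst a)).
  have D : is_derive x 1 w _ := @is_derive1_comp R Num.sqrt
    (fun y => (b - y) * (y - a)) x _ _ (is_derive1_sqrt z0) dz.
  apply: (is_derive_eq D); rewrite /GRing.scale /= -/(w x) !fctE; field.
  by rewrite gt_eqF.
have rw0 := rw_gt0 x. have M0 := M_gt0 (ltW ax).
have d1 := @is_derive_atan_div (fun y => y - d) (fun y => r + w y) x _ _ (lt0r_neq0 rw0)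
  (is_deriveB iX (cst d)) (is_deriveD (cst r) dw).
have d2 := @is_derive_atan_div N M x _ _ (lt0r_neq0 M0)
  (is_deriveB (is_deriveM (cst (d + c)) (is_deriveD iX (cst c))) (cst _))
  (is_deriveD (is_deriveM (cst r) (is_deriveD iX (cst c))) (is_deriveM (cst s) dw)).
have D : is_derive x 1 mp_primitive _ := is_deriveB (is_deriveD dw
  (is_deriveM (cst (2 * (d + c))) d1)) (is_deriveM (cst (2 * s)) d2).
apply: (is_derive_eq D); rewrite /GRing.scale /= !fctE.
rewrite /N /M !(subr0, add0r, addr0, mulr0, mulr1, mul1r).
apply: mp_primitive_identity => //; lra.
Qed.

Lemma semicircle_div_within : {within `[a, b], continuous (fun x => w x / (x + c))}.
Proof.
apply: continuous_in_subspaceT => x /set_mem; rewrite /= in_itv /= => /andP[ax _].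
exact: semicircle_div_continuous.
Qed.

(** At the endpoints w vanishes and both arctangents are taken at 1 or -1, that is pi / 4 or -pi /
    4. The case c = 0 gives the mass of the law, c = t its transform. *)
Lemma integral_semicircle_div :
  \int[mu]_(x in `[a, b]) (w x / (x + c)) = pi * (d + c - s).
Proof.
have cF x : a <= x -> mp_primitive z @[z --> x] --> mp_primitive x.
  exact: mp_primitive_continuous.
have wa : w a = 0 by rewrite /w subrr mulr0 sqrtr0.
have wb : w b = 0 by rewrite /w subrr mul0r sqrtr0.
have dF : derivable_oo_LRcontinuous mp_primitive a b.
  split.
  - move=> x; rewrite in_itv /= => xab.
    exact: (@ex_derive _ _ _ _ _ _ _ (mp_primitive_derive xab)).
  - exact: cvg_at_right_filter (cF _ (lexx _)).
  - exact: cvg_at_left_filter (cF _ (ltW ab)).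
rewrite /Rintegral (continuous_FTC2 ab semicircle_div_within dF); last first.
  move=> x; rewrite in_itv /= => xab; rewrite derive1E.
  exact: (@derive_val _ _ _ _ _ _ _ (mp_primitive_derive xab)).
rewrite /= /mp_primitive /F1 wa wb addr0.
have bc : 0 < b + c by move: ac ab; lra.
have ba : b - a != 0 by rewrite subr_eq0 gt_eqF.
have -> : (b - d) / r = 1 by field.
have -> : (a - d) / r = -1 by field.
have -> : N b / M b = 1 by rewrite /N /M wb; field; rewrite ba gt_eqF.
have -> : N a / M a = -1 by rewrite /N /M wa; field; rewrite ba gt_eqF.
by rewrite atanN atan1; field.
Qed.

End Primitive.
End MPIntegral.

(** * Mass, Stieltjes transform and distribution function of the Marchenko-Pastur law *)

Section MarchenkoPastur.
Variables (R : realType) (y : R).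
Hypothesis y01 : 0 < y < 1.
Local Notation mu := (@lebesgue_measure R).
Local Notation a := (mp_a y).
Local Notation b := (mp_b y).

Let q := Num.sqrt y.
Let q01 : 0 < q < 1.
Proof.
case/andP: y01 => y0 y1; rewrite sqrtr_gt0 y0 /= -(@sqrtr1 R).
by rewrite ltr_sqrt.
Qed.
Let qq : q ^+ 2 = y. Proof. by case/andP: y01 => y0 _; rewrite sqr_sqrtr// ltW. Qed.

Lemma mp_a_gt0 : 0 < a.
Proof. by case/andP: q01 => q0 q1; rewrite exprn_gt0// subr_gt0. Qed.

Lemma mp_a_lt_b : a < b.
Proof. by case/andP: q01 => q0 q1; rewrite /mp_a /mp_b -/q; nra. Qed.

(** Written with x + 0 so that it is the case c = 0 of the integrand above. *)
Definition mp_weight (x : R) := (2 * pi * y)^-1 * (semicircle a b x / (x + 0)).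

Definition mp_integral (f : R -> R) : R := \int[mu]_(x in `[a, b]) (f x * mp_weight x).

(** Continuity is asked only at nonnegative points, where the spectra and the law live; 1 / (x + t)
    has a pole at -t. *)
Definition mp_test (f : R -> R) := forall x, 0 <= x -> {for x, continuous f}.

Let piy : 0 < 2 * pi * y.
Proof. by case/andP: y01 => y0 _; rewrite !mulr_gt0// pi_gt0. Qed.

Lemma mp_weight_ge0 x : a <= x -> 0 <= mp_weight x.
Proof.
move=> ax; rewrite mulr_ge0 ?invr_ge0 ?(ltW piy)// divr_ge0 ?sqrtr_ge0// addr0.
exact: le_trans (ltW mp_a_gt0) ax.
Qed.

Lemma mp_densityE x : mp_density y x = (mp_weight \_ `[a, b]) x.
Proof.
rewrite patchE mem_setE /mp_density in_itv /=; case: ifP => // _.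
rewrite /mp_weight addr0 [LHS]mulrC [RHS]mulrCA -invfM.
by congr (_ * _^-1); ring.
Qed.

Lemma mp_cdfE x : mp_cdf y x = \int[mu]_(t in `[a, b] `&` `]-oo, x]) mp_weight t.
Proof.
rewrite /mp_cdf setIC Rintegral_mkcondr; apply: eq_Rintegral => t _.
exact: mp_densityE.
Qed.

Lemma mp_cdf_integral x :
  mp_cdf y x = \int[mu]_(t in `[a, b]) ((t <= x)%R%:R * mp_weight t).
Proof.
rewrite mp_cdfE Rintegral_mkcondr; apply: eq_Rintegral => t _.
by rewrite patchE mem_setE in_itv /=; case: ifP; rewrite ?mul1r ?mul0r.
Qed.

Let mab : measurable (`[a, b]%classic : set (measurableTypeR R)). Proof. exact: measurable_itv. Qed.

Lemma mp_test_integrable f : mp_test f ->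
  mu.-integrable `[a, b] (EFin \o (fun x => f x * mp_weight x)).
Proof.
move=> tf; apply: continuous_compact_integrable; first exact: segment_compact.
apply: continuous_in_subspaceT => x /set_mem; rewrite /= in_itv /= => /andP[ax _].
apply: cvgM; first by apply: tf; rewrite (le_trans (ltW mp_a_gt0)).
apply: cvgM; first exact: cvg_cst.
by apply: semicircle_div_continuous => //; rewrite addr0 mp_a_gt0.
Qed.

Lemma mp_test_cst (k : R) : mp_test (fun=> k).
Proof. by move=> x _; exact: cvg_cst. Qed.

Lemma mp_integrable_indic x :
  mu.-integrable `[a, b] (EFin \o (fun t => (t <= x)%R%:R * mp_weight t)).
Proof.
have -> : EFin \o (fun t => (t <= x)%R%:R * mp_weight t) =
    (EFin \o mp_weight) \_ (`]-oo, x] : set R).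
  apply/funext => t; rewrite patchE mem_setE in_itv /=.
  by case: ifP; rewrite ?mul1r ?mul0r.
apply/integrable_restrict => //; apply: (integrableS mab) => //.
- exact: measurableI.
- by apply: eq_integrable (mp_test_integrable (@mp_test_cst 1)) => // t _ /=; rewrite mul1r.
Qed.

Lemma mp_integralD f g (k : R) : mp_test f -> mp_test g ->
  mp_integral (fun x => f x + k * g x) = mp_integral f + k * mp_integral g.
Proof.
move=> tf tg; have If := mp_test_integrable tf; have Ig := mp_test_integrable tg.
rewrite /mp_integral -RintegralZl// -RintegralD//; last first.
  by apply: eq_integrable (integrableZl mab k Ig) => // x _; rewrite /= EFinM.
by apply: eq_Rintegral => x _; rewrite mulrDl mulrA.
Qed.

Lemma mp_integral_le f g : mp_test f -> mp_test g ->
  (forall x, 0 <= x -> f x <= g x) -> mp_integral f <= mp_integral g.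
Proof.
move=> tf tg fg; apply: le_Rintegral => //; try exact: mp_test_integrable.
move=> x /=; rewrite in_itv /= => /andP[ax _].
by rewrite ler_wpM2r ?mp_weight_ge0// fg// (le_trans (ltW mp_a_gt0)).
Qed.

(** Here (a + b) / 2 = 1 + y and, as y < 1, the root of a b is 1 - y; the integral is pi (2 y),
    which the normalization cancels. *)
Lemma mp_integral1 : mp_integral (fun=> 1) = 1.
Proof.
rewrite /mp_integral; under eq_Rintegral do rewrite mul1r.
have ac : 0 < a + 0 by rewrite addr0 mp_a_gt0.
rewrite RintegralZl//; last first.
  apply: continuous_compact_integrable; first exact: segment_compact.
  exact: semicircle_div_within ac.
rewrite (integral_semicircle_div ac mp_a_lt_b) !addr0.
have -> : Num.sqrt (a * b) = 1 - y.
  have -> : a * b = (1 - y) ^+ 2 by rewrite /mp_a /mp_b -/q -qq; ring.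
  by rewrite sqrtr_sqr ger0_norm//; case/andP: y01; lra.
rewrite /mp_a /mp_b -/q.
have -> : ((1 - q) ^+ 2 + (1 + q) ^+ 2) / 2 = 1 + y by rewrite -qq; field.
have p0 : pi != 0 :> R by rewrite gt_eqF// pi_gt0.
have y0 : y != 0 by case/andP: y01 => y0 _; rewrite gt_eqF.
by move: (@pi R) p0 => P p0; field; rewrite y0 p0.
Qed.

Lemma mp_test_inv (t : R) : 0 < t -> mp_test (fun x => (x + t)^-1).
Proof.
move=> t0 x x0; apply: cvgV; first by rewrite gt_eqF// ltr_wpDl.
by apply: cvgD; [exact: cvg_id|exact: cvg_cst].
Qed.

(** The nonnegative root of t g^2 + (t - 1 + y) g - 1 = 0, which is the self-consistent equation
    cleared of its denominator. *)
Definition mp_fixpoint (t : R) :=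
  (Num.sqrt ((t - 1 + y) ^+ 2 + 4 * t) - (t - 1 + y)) / (2 * t).

Section MPFixpoint.
Variable t : R.
Hypothesis t0 : 0 < t.
Let D := Num.sqrt ((t - 1 + y) ^+ 2 + 4 * t).
Let D2 : D ^+ 2 = (t - 1 + y) ^+ 2 + 4 * t.
Proof. by rewrite sqr_sqrtr// addr_ge0 ?sqr_ge0// mulr_ge0// ltW. Qed.
Let D0 : 0 <= D. Proof. exact: sqrtr_ge0. Qed.

Lemma mp_fixpoint_ge0 : 0 <= mp_fixpoint t.
Proof.
rewrite divr_ge0//; last by rewrite mulr_ge0// ltW.
by move: D2 D0 t0; rewrite subr_ge0 -/D; move: D => E h1 h2 h3; nra.
Qed.

Lemma mp_fixpointE : t * mp_fixpoint t = 1 - y + y / (1 + mp_fixpoint t).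
Proof.
have g0 := mp_fixpoint_ge0; have tn : t != 0 by rewrite gt_eqF.
have gn : 1 + mp_fixpoint t != 0 by rewrite gt_eqF// ltr_pwDl.
have e : t * mp_fixpoint t ^+ 2 = 1 - (t - 1 + y) * mp_fixpoint t.
  have -> : t * mp_fixpoint t ^+ 2 =
      (D ^+ 2 - 2 * (t - 1 + y) * D + (t - 1 + y) ^+ 2) / (4 * t).
    by rewrite /mp_fixpoint -/D; field.
  by rewrite D2 /mp_fixpoint -/D; field.
move: (mp_fixpoint t) e gn => g e gn; apply: (mulIf gn); rewrite [RHS]mulrDl divfK//.
by transitivity (t * g + t * g ^+ 2); [ring|rewrite e; ring].
Qed.

(** Partial fractions: 1 / (x (x + t)) = (1 / x - 1 / (x + t)) / t reduces to two semicircle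
    integrals. *)
Lemma mp_integral_inv :
  mp_integral (fun x => (x + t)^-1) = (mp_fixpoint t - (1 - y) / t) / y.
Proof.
have ac : 0 < a + 0 by rewrite addr0 mp_a_gt0.
have act : 0 < a + t by rewrite addr_gt0// mp_a_gt0.
have I c (h : 0 < a + c) :
    mu.-integrable `[a, b] (EFin \o (fun x => semicircle a b x / (x + c))).
  apply: continuous_compact_integrable; first exact: segment_compact.
  exact: semicircle_div_within h.
transitivity ((2 * pi * y)^-1 / t * \int[mu]_(x in `[a, b])
   (semicircle a b x / (x + 0) - semicircle a b x / (x + t))).
  rewrite -RintegralZl//; last first.
    have := integrableB mab (I _ ac) (I _ act).
    by apply: eq_integrable => // x _; rewrite /= EFinB.
  apply: eq_Rintegral => x; rewrite inE /= in_itv /= => /andP[ax _].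
  have x0 : 0 < x by apply: lt_le_trans ax; exact: mp_a_gt0.
  rewrite /mp_weight addr0.
  have xt : x + t != 0 by rewrite gt_eqF// addr_gt0.
  move: piy (semicircle a b x) => /lt0r_neq0; move: (2 * pi * y) => P Pn W.
  by field; rewrite xt Pn !gt_eqF.
rewrite RintegralB//; [|exact: I|exact: I].
rewrite (integral_semicircle_div ac mp_a_lt_b) (integral_semicircle_div act mp_a_lt_b) !addr0.
have -> : Num.sqrt (a * b) = 1 - y.
  have -> : a * b = (1 - y) ^+ 2 by rewrite /mp_a /mp_b -/q -qq; ring.
  by rewrite sqrtr_sqr ger0_norm//; case/andP: y01; lra.
(* The product (a + t) (b + t) is exactly the discriminant of the quadratic equation for g. *)
have -> : Num.sqrt ((a + t) * (b + t)) = D.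
  by congr Num.sqrt; rewrite /mp_a /mp_b -/q -qq; ring.
have p0 : pi != 0 :> R by rewrite gt_eqF// pi_gt0.
have y0 : y != 0 by case/andP: y01 => y0 _; rewrite gt_eqF.
move: (@pi R) p0 => P p0.
by rewrite /mp_fixpoint -/D; field; rewrite y0 p0 gt_eqF.
Qed.

End MPFixpoint.

(** The error e is integrated as a constant function and costs exactly e, the law having mass
    one. *)
Lemma mp_integral_ge_cdf f (x e : R) : mp_test f ->
  (forall z, 0 <= z -> (z <= x)%R%:R <= f z + e) -> mp_cdf y x <= mp_integral f + e.
Proof.
move=> tf fx; have -> : mp_integral f + e = mp_integral f + e * mp_integral (fun=> 1).
  by rewrite mp_integral1 mulr1.
rewrite mp_cdf_integral.
have tfe : mp_test (fun z => f z + e * 1).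
  by move=> z z0; apply: cvgD; [exact: tf|exact: cvg_cst].
rewrite -(mp_integralD _ tf (@mp_test_cst 1)); apply: le_Rintegral => //.
- exact: mp_integrable_indic.
- exact: mp_test_integrable.
move=> z /=; rewrite in_itv /= => /andP[az _].
by rewrite ler_wpM2r ?mp_weight_ge0// mulr1 fx// (le_trans (ltW mp_a_gt0)).
Qed.

Lemma mp_integral_le_cdf f (x e : R) : mp_test f ->
  (forall z, 0 <= z -> f z <= (z <= x)%R%:R + e) -> mp_integral f <= mp_cdf y x + e.
Proof.
move=> tf fx; have -> : mp_cdf y x + e = mp_cdf y x + e * mp_integral (fun=> 1).
  by rewrite mp_integral1 mulr1.
rewrite -lerBlDr mp_cdf_integral -mulNr.
have tfe : mp_test (fun z => f z + - e * 1).
  by move=> z z0; apply: cvgD; [exact: tf|exact: cvg_cst].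
rewrite -(mp_integralD _ tf (@mp_test_cst 1)); apply: le_Rintegral => //.
- exact: mp_test_integrable.
- exact: mp_integrable_indic.
move=> z /=; rewrite in_itv /= => /andP[az _].
rewrite ler_wpM2r ?mp_weight_ge0// mulr1 lerBlDr fx//.
by rewrite (le_trans (ltW mp_a_gt0)).
Qed.

(** A crude bound for the density: the root is at most b - a, and 1 / x at most 1 / a, where a >
    0. *)
Let K := (2 * pi * y)^-1 * ((b - a) / a).

Lemma mp_weight_le x : a <= x <= b -> mp_weight x <= K.
Proof.
move=> /andP[ax xb]; have a0 := mp_a_gt0.
have x0 : 0 < x by exact: lt_le_trans ax.
rewrite ler_pM2l ?invr_gt0// addr0.
apply: ler_pM; rewrite ?sqrtr_ge0 ?invr_ge0 ?(ltW x0)//; last first.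
  by rewrite lef_pV2 ?posrE.
have ba : 0 <= b - a by rewrite subr_ge0 (le_trans ax).
rewrite -[X in _ <= X]ger0_norm// -sqrtr_sqr ler_wsqrtr//.
by rewrite expr2; apply: ler_pM; rewrite ?subr_ge0// ?lerB.
Qed.

(** The increment integrates the density over ]x, z], where it is at most K. It lets the point x be
    replaced by a small window. *)
Lemma mp_cdf_lipschitz x z : x <= z -> mp_cdf y z <= mp_cdf y x + K * (z - x).
Proof.
move=> xz; rewrite -lerBlDl !mp_cdf_integral -RintegralB//; try exact: mp_integrable_indic.
have K0 : 0 <= K.
  apply: le_trans (mp_weight_ge0 (lexx _)) (mp_weight_le _).
  by rewrite lexx ltW// mp_a_lt_b.
pose ind t : R := \1_(`]x, z] : set R) t.
have I1 : mu.-integrable `[a, b] (EFin \o ind).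
  exact: integrableS measurableT mab (@subsetT _ _) (integrable_indic_itv x z false false).
have Iind : mu.-integrable `[a, b] (EFin \o (fun t => K * ind t)).
  by apply: eq_integrable (integrableZl mab K I1) => // t _; rewrite /= EFinM.
apply: le_trans (_ : \int[mu]_(t in `[a, b]) (K * ind t) <= _).
  apply: le_Rintegral => //.
    have := integrableB mab (mp_integrable_indic z) (mp_integrable_indic x).
    by apply: eq_integrable => // t _; rewrite /= EFinB.
  move=> t /=; rewrite in_itv /= => tab; rewrite -mulrBl /ind indicE mem_setE in_itv /=.
  case: (leP t x) => tx; rewrite ?(le_trans tx xz) /=.
    by rewrite subrr mul0r mulr0.
  case: (leP t z) => tz; last by rewrite subrr mul0r mulr0.
  by rewrite subr0 mul1r mulr1 mp_weight_le.
rewrite RintegralZl// ler_wpM2l//.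
have mxz : measurable (`]x, z]%classic : set (measurableTypeR R)) by exact: measurable_itv.
rewrite /Rintegral (integral_indic mu mab mxz).
have lxz : mu `]x, z] = (z - x)%:E.
  rewrite lebesgue_measure_itv /= lte_fin; case: ltP => [_|zx].
    by rewrite EFinN -EFinB.
  have -> : z = x by apply/eqP; rewrite eq_le xz zx.
  by rewrite subrr.
have le1 : (mu (`]x, z] `&` `[a, b]) <= (z - x)%:E)%E.
  rewrite -lxz; apply: le_measure; rewrite ?inE//; first exact: measurableI.
rewrite -[z - x]/(fine (z - x)%:E) fine_le// ge0_fin_numE//.
by rewrite (le_lt_trans le1)// ltry.
Qed.

End MarchenkoPastur.

(** * From Stieltjes transforms to distribution functions *)

Section Bernstein.
Variable R : realType.

(** Its value at v is the expectation of f(S) for S binomial with parameters N and v, computed by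
    conditioning on one trial; this is a Bernstein polynomial without binomial coefficients. *)
Fixpoint bern (N : nat) (f : nat -> R) : {poly R} :=
  if N is N'.+1 then 'X * bern N' (fun k => f k.+1) + (1 - 'X) * bern N' f
  else (f 0%N)%:P.

Lemma bernS N f v :
  (bern N.+1 f).[v] = v * (bern N (fun k => f k.+1)).[v] + (1 - v) * (bern N f).[v].
Proof. by rewrite /= !hornerE. Qed.

Lemma bern_affine N (f : nat -> R) (c k : R) v :
  (bern N (fun i => c + k * f i)).[v] = c + k * (bern N f).[v].
Proof.
elim: N f => [|N IH] f; first by rewrite /= !hornerE.
by rewrite !bernS !IH; ring.
Qed.

Lemma bern_le N (f g : nat -> R) v : 0 <= v <= 1 -> (forall i, f i <= g i) ->
  (bern N f).[v] <= (bern N g).[v].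
Proof.
move=> /andP[v0 v1]; elim: N f g => [|N IH] f g fg; first by rewrite /= !hornerE.
by rewrite !bernS lerD// ler_wpM2l ?subr_ge0// IH.
Qed.

(** The binomial variance plus the squared distance from the mean N v to c. *)
Lemma bern_sqr N (c v : R) : (bern N (fun i => (i%:R - c) ^+ 2)).[v] =
  N%:R * v * (1 - v) + (N%:R * v - c) ^+ 2.
Proof.
elim: N c => [|N IH] c; first by rewrite /= !hornerE; ring.
rewrite bernS IH.
have -> : (fun k : nat => (k.+1%:R - c) ^+ 2) = (fun k => (k%:R - (c - 1)) ^+ 2).
  by apply/funext => k; rewrite -natr1; congr (_ ^+ 2); ring.
by rewrite IH -natr1; ring.
Qed.

Lemma bern_cst N (c v : R) : (bern N (fun=> c)).[v] = c.
Proof.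
elim: N => [|N IH]; first by rewrite /= !hornerE.
by rewrite bernS !IH; ring.
Qed.

(* Chebyshev's inequality for the binomial law. *)
Lemma poly_step (u1 u0 e : R) : u1 < u0 -> 0 < e ->
  exists P : {poly R}, forall v, 0 <= v <= 1 ->
    [/\ 0 <= P.[v] <= 1, u0 <= v -> 1 - e <= P.[v] & v <= u1 -> P.[v] <= e].
Proof.
move=> u10 e0; pose g := (u0 - u1) / 2; pose c := (u0 + u1) / 2.
have g0 : 0 < g by rewrite /g; lra.
have cg0 : c + g = u0 by rewrite /c /g; field.
have cg1 : c - g = u1 by rewrite /c /g; field.
clearbody c g.
(* The Chebyshev bound at distance N g from the mean is 1 / (N g^2); this N makes it at most e. *)
pose N := (Num.truncn ((e * g ^+ 2)^-1)).+1.
have N0 : 0 < N%:R :> R by rewrite ltr0n.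
have h : 0 <= (e * g ^+ 2)^-1.
  by rewrite invr_ge0 ltW// mulr_gt0// exprn_gt0.
have Ne : (N%:R * g ^+ 2)^-1 <= e.
  rewrite -[e]invrK lef_pV2 ?posrE ?invr_gt0 ?mulr_gt0 ?exprn_gt0//.
  rewrite -ler_pdivrMr ?exprn_gt0// -invfM ltW//.
  by case/andP: (truncn_itv h).
clear h.
pose f (i : nat) : R := (N%:R * c <= i%:R)%R%:R.
have Ng : 0 < (N%:R * g) ^+ 2 by rewrite exprn_gt0// mulr_gt0.
have hS (v : R) : 0 <= v <= 1 ->
    ((N%:R * g) ^+ 2)^-1 * (bern N (fun i => (i%:R - N%:R * v) ^+ 2)).[v] <= e.
  move=> /andP[v0 v1]; rewrite bern_sqr subrr expr0n addr0.
  apply: le_trans Ne.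
  have -> : (N%:R * g ^+ 2)^-1 = ((N%:R * g) ^+ 2)^-1 * N%:R.
    by field; rewrite !gt_eqF.
  by rewrite ler_pM2l ?invr_gt0// -mulrA ler_piMr ?(ltW N0)//; nra.
exists (bern N f) => v v01; split.
- apply/andP; split.
    by have := @bern_le N (fun=> 0) f v v01; rewrite bern_cst; apply=> i; rewrite /f ler0n.
  by have := @bern_le N f (fun=> 1) v v01; rewrite bern_cst; apply=> i; rewrite /f lern1 leq_b1.
(* The indicator f dominates 1 - (i - N v)^2 / (N g)^2: where it vanishes, i < N c lies at least N g
   below N v. *)
- move=> u0v; apply: (@le_trans _ _ (1 - ((N%:R * g) ^+ 2)^-1 *
      (bern N (fun i => (i%:R - N%:R * v) ^+ 2)).[v])).
    by rewrite lerB// hS.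
  rewrite -mulNr -bern_affine; apply: bern_le => // i.
  rewrite mulNr /f; case: (leP (N%:R * c) i%:R) => h.
    by rewrite lerBlDr lerDl mulr_ge0 ?sqr_ge0 ?invr_ge0 ?(ltW Ng).
  rewrite subr_le0 ler_pdivlMl// mulr1.
  have h2 : N%:R * g <= N%:R * v - i%:R.
    rewrite lerBrDr -lerBrDl -mulrBr; apply: le_trans (ltW h) _.
    by rewrite ler_pM2l//; lra.
  by rewrite -[X in _ <= X]sqrrN opprB; apply: lerXn2r; rewrite ?nnegrE ?mulr_ge0 ?(ltW N0) ?(ltW g0)// (le_trans _ h2)// mulr_ge0 ?(ltW N0) ?(ltW g0).
- move=> vu1; apply: le_trans (hS v v01).
  rewrite -[X in _ <= X]add0r -bern_affine; apply: bern_le => // i; rewrite add0r.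
  rewrite /f /=; case: (leP (N%:R * c) i%:R) => h; last by rewrite mulr_ge0 ?sqr_ge0 ?invr_ge0 ?(ltW Ng).
  rewrite ler_pdivlMl// mulr1.
  have h2 : N%:R * g <= i%:R - N%:R * v.
    rewrite lerBrDr -mulrDr; apply: le_trans h.
    by rewrite ler_pM2l//; lra.
  by apply: lerXn2r; rewrite ?nnegrE ?mulr_ge0 ?(ltW N0) ?(ltW g0)// (le_trans _ h2)// mulr_ge0 ?(ltW N0) ?(ltW g0).
Qed.

(** The substitution v = 1 / (1 + z) maps the half-line into [0, 1] and reverses the order, so a
    polynomial step in v becomes a cutoff in z. *)
Lemma poly_cutoff (x x' e : R) : x < x' -> 0 < e ->
  exists P : {poly R}, forall z, 0 <= z ->
    (z <= x)%R%:R <= P.[(1 + z)^-1] + e /\ P.[(1 + z)^-1] <= (z <= x')%R%:R + e.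
Proof.
(* For x' <= 0 no z >= 0 satisfies z <= x, and the zero polynomial works. *)
move=> xx' e0; case: (leP x' 0) => x'0.
  exists 0 => z z0; rewrite hornerE add0r; split; last by rewrite addr_ge0// ltW.
  by rewrite (leNgt z x) (lt_le_trans xx' (le_trans x'0 z0)) ltW.
pose x0 := Num.max x 0.
have x00 : 0 <= x0 by rewrite le_max lexx orbT.
have x0x : x0 < x' by rewrite gt_max xx'.
have u10 : (1 + x')^-1 < (1 + x0)^-1 by rewrite ltf_pV2 ?posrE; lra.
have [P HP] := poly_step u10 e0; exists P => z z0.
have /HP[/andP[P0 P1] Pl Pr] : 0 <= (1 + z)^-1 <= 1.
  by rewrite invr_ge0 invf_le1; lra.
split.
- case: (leP z x) => zx; last by rewrite addr_ge0// ltW.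
  rewrite -lerBlDr Pl// lef_pV2 ?posrE; try lra.
  by rewrite lerD2l le_max zx.
- case: (leP z x') => zx; first by rewrite ler_wpDr// ltW.
  by rewrite add0r Pr// lef_pV2 ?posrE; lra.
Qed.

End Bernstein.

(** * From convergence of linear statistics to convergence of distribution functions *)

Section Deviation.
Variables (R : realType) (y : R).
Hypothesis y01 : 0 < y < 1.

Section OneLevel.
Variables (T : finType) (sp : T -> seq R) (p : nat).
Hypotheses (p_gt0 : (0 < p)%N) (T_gt0 : (0 < #|T|)%N).
Hypotheses (size_sp : forall s, size (sp s) = p) (sp_ge0 : forall s r, r \in sp s -> 0 <= r).

Definition empirical (s : T) (f : R -> R) : R := (\sum_(r <- sp s) f r) / p%:R.

(** An L1 error for uniform s: the functions for which it tends to zero are closed under linear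
    combinations and uniform limits. *)
Definition mean_dev (f : R -> R) : R :=
  (\sum_s `|empirical s f - mp_integral y f|) / #|T|%:R.

Let pp : 0 < p%:R :> R. Proof. by rewrite ltr0n. Qed.
Let TT : 0 < #|T|%:R :> R. Proof. by rewrite ltr0n. Qed.

Lemma empirical_affine s f g (k : R) :
  empirical s (fun x => f x + k * g x) = empirical s f + k * empirical s g.
Proof. by rewrite /empirical big_split /= -mulr_sumr mulrDl mulrA. Qed.

Lemma empirical_cst s (k : R) : empirical s (fun=> k) = k.
Proof.
rewrite /empirical big_const_seq count_predT size_sp iter_addr_0 -[k *+ p]mulr_natr.
by rewrite mulfK// gt_eqF.
Qed.

Lemma empirical_le s f g : (forall x, 0 <= x -> f x <= g x) ->
  empirical s f <= empirical s g.
Proof.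
move=> fg; rewrite ler_pM2r ?invr_gt0// big_seq [X in _ <= X]big_seq.
by apply: ler_sum => r /sp_ge0; exact: fg.
Qed.

Lemma mean_dev_ge0 f : 0 <= mean_dev f.
Proof. by rewrite divr_ge0// sumr_ge0. Qed.

Lemma mean_dev_affine f g (k : R) : mp_test f -> mp_test g ->
  mean_dev (fun x => f x + k * g x) <= mean_dev f + `|k| * mean_dev g.
Proof.
move=> tf tg; rewrite /mean_dev mulrA -mulrDl ler_pM2r ?invr_gt0// mulr_sumr -big_split /=.
apply: ler_sum => s _; rewrite -normrM mp_integralD// empirical_affine.
by apply: le_trans (ler_normD _ _); rewrite opprD addrACA mulrBr.
Qed.

Lemma mean_dev_cst (k : R) : mean_dev (fun=> k) = 0.
Proof.
have Jk : mp_integral y (fun=> k) = k.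
  have := mp_integralD y01 k (mp_test_cst (R := R) (k := 0)) (mp_test_cst (k := 1)).
  have J0 : mp_integral y (fun=> 0) = 0.
    by rewrite /mp_integral; under eq_Rintegral do rewrite mul0r; rewrite Rintegral_cst ?mul0r.
  rewrite mp_integral1// J0 mulr1 add0r => e; rewrite -[RHS]e.
  by congr mp_integral; apply/funext => x; rewrite mulr1 add0r.
by rewrite /mean_dev big1 ?mul0r// => s _; rewrite empirical_cst Jk subrr normr0.
Qed.

Lemma mean_dev_unif f g (e : R) : mp_test f -> mp_test g ->
  (forall x, 0 <= x -> `|f x - g x| <= e) -> mean_dev f <= mean_dev g + 2 * e.
Proof.
move=> tf tg fg.
(* Stated for any positive linear functional of mass one, then used for the law and for each
   empirical measure; each contributes one e. *)
have sandwich (I : (R -> R) -> R) :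
    (forall u v, mp_test u -> mp_test v -> (forall x, 0 <= x -> u x <= v x) -> I u <= I v) ->
    (forall u v k, mp_test u -> mp_test v -> I (fun x => u x + k * v x) = I u + k * I v) ->
    I (fun=> 1) = 1 -> `|I f - I g| <= e.
  move=> Ile IA I1; have t1 : mp_test (fun=> 1 : R) by exact: mp_test_cst.
  have tge k : mp_test (fun x => g x + k * 1).
    by move=> x x0; apply: cvgD; [exact: tg|exact: cvg_cst].
  have hu : I f <= I (fun x => g x + e * 1).
    by apply: Ile => // x /fg; rewrite ler_norml => /andP[_]; lra.
  have hl : I (fun x => g x + - e * 1) <= I f.
    by apply: Ile => // x /fg; rewrite ler_norml => /andP[+ _]; lra.
  by move: hu hl; rewrite !IA// I1 ler_norml; lra.
have hJ := sandwich (mp_integral y)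
  (fun u v => @mp_integral_le _ _ y01 u v) (fun u v k => @mp_integralD _ _ y01 u v k)
  (mp_integral1 y01).
have hE s := sandwich (empirical s) (fun u v _ _ => @empirical_le s u v)
  (fun u v k _ _ => empirical_affine s u v k) (empirical_cst s 1).
rewrite /mean_dev ler_pdivrMr// mulrDl divfK ?gt_eqF//.
have -> : 2 * e * #|T|%:R = \sum_(s : T) (2 * e) by rewrite sumr_const mulr_natr.
rewrite -big_split /=; apply: ler_sum => s _.
have -> : empirical s f - mp_integral y f = (empirical s g - mp_integral y g) +
  ((empirical s f - empirical s g) - (mp_integral y f - mp_integral y g)) by ring.
apply: le_trans (ler_normD _ _) _; rewrite lerD2l.
apply: le_trans (ler_normB _ _) _.
by have := hE s; lra.
Qed.

(** When the empirical distribution function is off by more than eps, the statistic of f (if too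
    large) or of g (if too small) is off by more than eps / 2; Markov's inequality gives the factor
    2 / eps. *)
Lemma tail_le_mean_dev (x eps e : R) (f g : R -> R) :
  mp_test f -> mp_test g -> 0 < eps ->
  (forall z, 0 <= z -> (z <= x)%R%:R <= f z + e) ->
  (forall z, 0 <= z -> g z <= (z <= x)%R%:R + e) ->
  mp_integral y f + e <= mp_cdf y x + eps / 2 ->
  mp_cdf y x - eps / 2 <= mp_integral y g - e ->
  #|[set s | eps < `|(count (fun r => r <= x) (sp s))%:R / p%:R - mp_cdf y x| ]%SET|%:R / #|T|%:R
    <= 2 / eps * (mean_dev f + mean_dev g).
Proof.
move=> tf tg eps0 fx gx Jf Jg.
have cE s : (count (fun r => r <= x) (sp s))%:R / p%:R = empirical s (fun z => (z <= x)%R%:R).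
  by rewrite /empirical -sum1_count natr_sum big_mkcond /=; congr (_ / _); apply: eq_bigr => r _; case: ifP.
rewrite /mean_dev -mulrDl mulrA ler_pM2r ?invr_gt0// -big_split /=.
rewrite -sum1_card natr_sum big_mkcond /= mulr_sumr; apply: ler_sum => s _.
rewrite inE cE; case: ifP => [h|_]; last by rewrite mulr_ge0// ?addr_ge0// divr_ge0// ltW.
have h1 : empirical s (fun z => (z <= x)%R%:R) <= empirical s f + e.
  have -> : empirical s f + e = empirical s (fun z => f z + e * 1).
    by rewrite empirical_affine empirical_cst mulr1.
  apply: empirical_le => z z0.
  by rewrite mulr1 fx.
have h2 : empirical s g - e <= empirical s (fun z => (z <= x)%R%:R).
  have -> : empirical s g - e = empirical s (fun z => g z + - e * 1).
    by rewrite empirical_affine empirical_cst mulr1.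
  apply: empirical_le => z z0.
  by rewrite mulr1 lerBlDr gx.
rewrite mulrAC ler_pdivlMr// mul1r.
move: h; rewrite lter_normr => /orP[] h.
  have := ler_norm (empirical s f - mp_integral y f).
  by have := normr_ge0 (empirical s g - mp_integral y g); lra.
have := ler_norm (- (empirical s g - mp_integral y g)); rewrite normrN.
by have := normr_ge0 (empirical s f - mp_integral y f); lra.
Qed.

End OneLevel.

Variables (T : nat -> finType) (sp : forall k, T k -> seq R) (p : nat -> nat).
Hypotheses (p_gt0 : forall k, (0 < p k)%N) (T_gt0 : forall k, (0 < #|T k|)%N).
Hypotheses (size_sp : forall k s, size (@sp k s) = p k).
Hypotheses (sp_ge0 : forall k s r, r \in @sp k s -> 0 <= r).

Local Notation dev k := (mean_dev (@sp k) (p k)).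

Definition mean_cvg (f : R -> R) := mp_test f /\
  forall e, 0 < e -> exists K, forall k, (K <= k)%N -> dev k f <= e.

Lemma mean_cvg_cst c : mean_cvg (fun=> c).
Proof.
split=> [|e e0]; first exact: mp_test_cst.
by exists 0%N => k _; rewrite mean_dev_cst// ltW.
Qed.

Lemma mean_cvg_affine f g c : mean_cvg f -> mean_cvg g ->
  mean_cvg (fun x => f x + c * g x).
Proof.
move=> [tf cf] [tg cg]; split=> [x x0|e e0].
  by apply: cvgD; [exact: tf|apply: cvgM; [exact: cvg_cst|exact: tg]].
have c0 : 0 < `|c| + 1 by rewrite ltr_wpDl.
have e2 : 0 < e / 2 by lra.
have [K1 h1] := cf _ e2; have [K2 h2] := cg _ (divr_gt0 e2 c0).
exists (maxn K1 K2) => k; rewrite geq_max => /andP[/h1 h1k /h2 h2k].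
apply: le_trans; first exact: mean_dev_affine.
have : `|c| * dev k g <= e / 2; last by lra.
rewrite -(divfK (lt0r_neq0 c0) (e / 2)) mulrC.
by apply: ler_pM; rewrite ?mean_dev_ge0// lerDl.
Qed.

Lemma mean_cvg_unif f : mp_test f ->
  (forall e, 0 < e -> exists2 g, mean_cvg g & forall x, 0 <= x -> `|f x - g x| <= e) ->
  mean_cvg f.
Proof.
move=> tf h; split=> // e e0.
have e4 : 0 < e / 4 by lra.
have [g [tg cg] fg] := h _ e4; have [K hK] := cg _ e4.
exists K => k /hK hk; have := mean_dev_unif (p_gt0 k) (T_gt0 k) (@size_sp k) (@sp_ge0 k) tf tg fg.
by lra.
Qed.

Hypothesis stieltjes_cvg : forall t, 0 < t -> mean_cvg (fun x => (x + t)^-1).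

(** Interpolates between the Stieltjes kernel at t = 1 - h, for j = 0, and the power j + 1 of 1 / (1
    + x), for h = 0. *)
Let psi j h (x : R) := (1 + x)^-1 ^+ j / (x + (1 - h)).

Lemma mp_test_psi j h : h < 1 -> mp_test (psi j h).
Proof.
move=> h1 x x0; apply: cvgM.
  have cu : {for x, continuous (fun z : R => (1 + z)^-1)}.
    apply: cvgV; first by rewrite gt_eqF// ltr_pwDl.
    by apply: cvgD; [exact: cvg_cst|exact: cvg_id].
  elim: j => [|j IH]; first by under eq_fun do rewrite expr0; exact: cvg_cst.
  by under eq_fun do rewrite exprS; rewrite exprS; exact: cvgM.
by apply: (mp_test_inv _ x0); rewrite subr_gt0.
Qed.

(* Iterated difference quotients of t |-> 1 / (x + t) at t = 1 produce the
   higher powers of 1 / (1 + x). *)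
Lemma mean_cvg_psi j h : 0 <= h < 1 -> mean_cvg (psi j h).
Proof.
elim: j h => [|j IH] h /andP[h0 h1].
  have -> : psi 0 h = (fun x => (x + (1 - h))^-1).
    by apply/funext => x; rewrite /psi expr0 mul1r.
  by apply: stieltjes_cvg; rewrite subr_gt0.
have quot k : 0 < k < 1 -> mean_cvg (fun x => 0 + k^-1 * (psi j k x + - 1 * psi j 0 x)).
  move=> /andP[k0 k1]; apply: mean_cvg_affine; first exact: mean_cvg_cst.
  by apply: mean_cvg_affine; apply: IH; rewrite ?lexx ?ltr01 ?(ltW k0).
(* From 1 / (x + 1 - k) - 1 / (x + 1) = k / ((x + 1) (x + 1 - k)); the leading 0 only fits the shape
   of [mean_cvg_affine]. *)
have quotE k x : 0 < k < 1 -> 0 <= x ->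
    0 + k^-1 * (psi j k x + - 1 * psi j 0 x) = psi j.+1 k x.
  move=> /andP[k0 k1] x0; rewrite /psi exprSr; move: (_ ^+ j) => A.
  by field; rewrite !gt_eqF//; lra.
apply: mean_cvg_unif; first exact: mp_test_psi.
move=> e e0; case: (ltP 0 h) => hp.
  exists (fun x => 0 + h^-1 * (psi j h x + - 1 * psi j 0 x)); first by apply: quot; rewrite hp.
  by move=> x x0; rewrite quotE ?hp// subrr normr0 ltW.
have {h0 hp} -> : h = 0 by apply/eqP; rewrite eq_le hp h0.
(* At h = 0 the function is the uniform limit of the quotients as k tends to 0: k <= 1 / 2 bounds 1
   / (x + 1 - k) by 2, and k <= e / 2 makes the error at most e. *)
pose k := Num.min (1 / 2) (e / 2).
have k0 : 0 < k by rewrite lt_min; apply/andP; split; lra.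
have k2 : k <= 1 / 2 by rewrite ge_min lexx.
have ke : k <= e / 2 by rewrite ge_min lexx orbT.
clearbody k; have k01 : 0 < k < 1 by rewrite k0; lra.
exists (fun x => 0 + k^-1 * (psi j k x + - 1 * psi j 0 x)); first exact: quot.
move=> x x0; rewrite quotE//.
have -> : psi j.+1 0 x - psi j.+1 k x = - (k * ((1 + x)^-1 ^+ j.+2 * (x + (1 - k))^-1)).
  rewrite /psi (exprSr _ j.+1); move: (_ ^+ j.+1) => A.
  by field; rewrite !gt_eqF//; lra.
have u0 : 0 <= (1 + x)^-1 by rewrite invr_ge0; lra.
have u1 : (1 + x)^-1 <= 1 by rewrite invf_le1; lra.
have A0 := exprn_ge0 j.+2 u0; have A1 := exprn_ile1 j.+2 u0 u1.
have w0 : 0 <= (x + (1 - k))^-1 by rewrite invr_ge0; lra.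
have w2 : (x + (1 - k))^-1 <= 2 by rewrite -[2]invrK lef_pV2 ?posrE; lra.
move: (_ ^+ _) (x + _)^-1 A0 A1 w0 w2 => A w A0 A1 w0 w2.
have Aw : A * w <= 1 * 2 by exact: ler_pM.
rewrite normrN ger0_norm ?mulr_ge0 ?(ltW k0)//.
apply: le_trans (_ : e / 2 * (1 * 2) <= _); last by lra.
by apply: ler_pM => //; rewrite ?mulr_ge0 ?(ltW k0).
Qed.

Lemma mean_cvg_poly (P : {poly R}) : mean_cvg (fun x => P.[(1 + x)^-1]).
Proof.
have -> : (fun x => P.[(1 + x)^-1]) = (fun x => \sum_(i < size P) P`_i * (1 + x)^-1 ^+ i).
  by apply/funext => x; rewrite horner_coef.
elim: (size P) => [|n IH].
  have -> : (fun x : R => \sum_(i < 0) P`_i * (1 + x)^-1 ^+ i) = (fun=> 0).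
    by apply/funext => x; rewrite big_ord0.
  exact: mean_cvg_cst.
have -> : (fun x => \sum_(i < n.+1) P`_i * (1 + x)^-1 ^+ i) =
    (fun x => \sum_(i < n) P`_i * (1 + x)^-1 ^+ i + P`_n * (1 + x)^-1 ^+ n).
  by apply/funext => x; rewrite big_ord_recr.
apply: mean_cvg_affine => //; case: n {IH} => [|n].
  have -> : (fun x : R => (1 + x)^-1 ^+ 0) = (fun=> 1) by apply/funext.
  exact: mean_cvg_cst.
have -> : (fun x : R => (1 + x)^-1 ^+ n.+1) = psi n 0.
  by apply/funext => x; rewrite /psi subr0 exprSr addrC.
by apply: mean_cvg_psi; rewrite lexx ltr01.
Qed.

(** Polynomial cutoffs descending on [x, x + h] and on [x - h, x] bracket the indicator; the
    Lipschitz bound pays for the two windows. *)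
Lemma cdf_cvg_in_probability (x eps e : R) : 0 < eps -> 0 < e ->
  exists K, forall k, (K <= k)%N ->
  #|[set s | eps < `|(count (fun r => r <= x) (@sp k s))%:R / (p k)%:R - mp_cdf y x| ]%SET|%:R
    / #|T k|%:R <= e.
Proof.
move=> eps0 e0.
pose L := (2 * pi * y)^-1 * ((mp_b y - mp_a y) / mp_a y).
(* A window costs at most eps / 8; with two errors eps / 16 this stays below eps / 2. *)
pose h := eps / (8 * (`|L| + 1)).
have L1 : 0 < `|L| + 1 by rewrite ltr_wpDl.
have h0 : 0 < h by rewrite divr_gt0// mulr_gt0.
have Lh : L * h <= eps / 8.
  rewrite /h invfM [eps * _]mulrA mulrCA -[X in _ <= X]mulr1 ler_pM2l; last by lra.
  by rewrite ler_pdivrMr// mul1r (le_trans (ler_norm _))// lerDl.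
have d0 : 0 < eps / 16 by lra.
have xh : x < x + h by rewrite ltrDl.
have hx : x - h < x by rewrite ltrBlDr ltrDl.
have [P hP] := poly_cutoff xh d0; have [Q hQ] := poly_cutoff hx d0.
have [tP cP] := mean_cvg_poly P; have [tQ cQ] := mean_cvg_poly Q.
have JP : mp_integral y (fun z => P.[(1 + z)^-1]) + eps / 16 <= mp_cdf y x + eps / 2.
  have h1 := mp_integral_le_cdf y01 tP (fun z z0 => (hP z z0).2).
  have := mp_cdf_lipschitz y01 (ltW xh); rewrite -/L.
  have -> : x + h - x = h by ring.
  by lra.
have JQ : mp_cdf y x - eps / 2 <= mp_integral y (fun z => Q.[(1 + z)^-1]) - eps / 16.
  have h1 := mp_integral_ge_cdf y01 tQ (fun z z0 => (hQ z z0).1).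
  have := mp_cdf_lipschitz y01 (ltW hx); rewrite -/L.
  have -> : x - (x - h) = h by ring.
  by lra.
(* Two mean deviations of this size, times 2 / eps, add up to e. *)
have e' : 0 < e * eps / 4 by rewrite divr_gt0// mulr_gt0.
have [K1 hK1] := cP _ e'; have [K2 hK2] := cQ _ e'.
exists (maxn K1 K2) => k; rewrite geq_max => /andP[/hK1 h1k /hK2 h2k].
have := tail_le_mean_dev (p_gt0 k) (T_gt0 k) (@size_sp k) (@sp_ge0 k) tP tQ eps0
  (fun z z0 => (hP z z0).1) (fun z z0 => (hQ z z0).2) JP JQ.
move=> /le_trans; apply.
rewrite mulrAC ler_pdivrMr//; lra.
Qed.

End Deviation.

(** * Convergence in probability along the sequence of mutually unbiased bases *)

Theorem theorem1 (R : realType) (y : R) (nn mm pp : nat -> nat)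
    (B : forall k : nat, 'I_(mm k) -> 'M[R[i]]_(nn k)) :
  0 < y < 1 ->
  (forall k, (2 <= nn k)%N) ->
  (forall k, (2 <= mm k)%N) ->
  (forall k, Num.sqrt ((nn k)%:R : R) <= (mm k)%:R) ->
  (forall k, ((pp k)%:R : R) / (nn k)%:R = y) ->
  (forall N : nat, exists K : nat, forall k, (K <= k)%N -> (N <= nn k)%N) ->
  (forall k, mutually_unbiased (B k)) ->
  forall (x eps : R), 0 < eps ->
    (fun k => @dev_prob R (nn k) (mm k) (pp k) (B k) y x eps) @ \oo --> (0 : R).
Proof.
move=> y01 n2 m2 nm pn ninf mub x eps eps0.
have n0 k : (0 < nn k)%N by exact: ltn_trans (n2 k).
have m0 k : (0 < mm k)%N by exact: ltn_trans (m2 k).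
have p0 k : (0 < pp k)%N.
  rewrite lt0n; apply/eqP => pk0; case/andP: y01 => y0 _.
  by move: y0; rewrite -(pn k) pk0 mul0r ltxx.
pose T k : finType := {ffun 'I_(pp k) -> 'I_(mm k) * 'I_(nn k)}.
have cT k : #|T k| = ((mm k * nn k) ^ pp k)%N.
  by rewrite card_ffun card_prod !card_ord.
have T0 k : (0 < #|T k|)%N by rewrite cT expn_gt0 muln_gt0 m0 n0.
pose sp k (s : T k) : seq R := spectrum (B k) s.
have size_sp k s : size (@sp k s) = pp k by exact: size_spectrum.
have sp_ge0 k s r : r \in @sp k s -> 0 <= r by exact: spectrum_ge0.
have stieltjes t : 0 < t -> mean_cvg y sp pp (fun z => (z + t)^-1).
  move=> t0; split=> [|e e0]; first exact: mp_test_inv.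
  (* Makes the first of the three terms of [mean_stieltjes_dev], d / t, equal to e / 3. *)
  pose d := e * t / 3.
  have d0 : 0 < d by rewrite divr_gt0// mulr_gt0.
  (* A common threshold: m >= M brings the second term, and n >= M the third, below e / 3. *)
  pose M := (maxn (Num.truncn (3 / (e * (t * (d * t ^+ 2))))) (Num.truncn (3 / (e * t ^+ 2)))).+1.
  have M1 : 3 / (e * (t * (d * t ^+ 2))) <= M%:R.
    have h : 0 <= 3 / (e * (t * (d * t ^+ 2))).
      by rewrite ltW// divr_gt0// !mulr_gt0// exprn_gt0.
    case/andP: (truncn_itv h) => _ /ltW /le_trans; apply.
    by rewrite ler_nat ltnS leq_maxl.
  have M2 : 3 / (e * t ^+ 2) <= M%:R.
    have h : 0 <= 3 / (e * t ^+ 2) by rewrite ltW// divr_gt0// mulr_gt0// exprn_gt0.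
    case/andP: (truncn_itv h) => _ /ltW /le_trans; apply.
    by rewrite ler_nat ltnS leq_maxr.
  (* Eventually n >= M^2, which yields both n >= M and m >= sqrt n >= M. *)
  clearbody M; have [K hK] := ninf (M * M)%N; exists K => k /hK Mn.
  have mR : 0 < (mm k)%:R :> R by rewrite ltr0n.
  have nR : 0 < (nn k)%:R :> R by rewrite ltr0n.
  have Mm : M%:R <= (mm k)%:R :> R.
    apply: le_trans (nm k).
    rewrite -[M%:R]ger0_norm// -sqrtr_sqr ler_wsqrtr//.
    by rewrite -natrX ler_nat expnS expn1.
  have MnR : M%:R <= (nn k)%:R :> R.
    by rewrite ler_nat (leq_trans _ Mn)//; case: (M) => // M'; rewrite leq_pmulr.
  rewrite /mean_dev /empirical (mp_integral_inv y01 t0) cT.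
  have hb := mean_stieltjes_dev (n0 k) (m0 k) (p0 k) (mub k) t0 (pn k)
    (mp_fixpoint_ge0 y t0) (mp_fixpointE y t0) d0.
  apply: le_trans hb _.
  have h1 : t^-1 * d = e / 3 by rewrite /d; field; rewrite gt_eqF.
  have h2 : t^-1 * (d * ((mm k)%:R * t ^+ 2))^-1 <= e / 3.
    rewrite -invfM -[e / 3]invrK lef_pV2 ?posrE ?invr_gt0 ?divr_gt0 ?mulr_gt0 ?exprn_gt0//.
    have -> : (e / 3)^-1 = 3 / (e * (t * (d * t ^+ 2))) * (t * (d * t ^+ 2)).
      by field; rewrite !gt_eqF.
    have -> : t * (d * ((mm k)%:R * t ^+ 2)) = (mm k)%:R * (t * (d * t ^+ 2)) by ring.
    rewrite ler_pM2r ?mulr_gt0 ?exprn_gt0//.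
    exact: le_trans M1 Mm.
  have h3 : (t ^+ 2 * (nn k)%:R)^-1 <= e / 3.
    rewrite -[e / 3]invrK lef_pV2 ?posrE ?invr_gt0 ?divr_gt0 ?mulr_gt0 ?exprn_gt0//.
    have -> : (e / 3)^-1 = t ^+ 2 * (3 / (e * t ^+ 2)).
      by field; rewrite !gt_eqF.
    rewrite ler_pM2l ?exprn_gt0//.
    exact: le_trans M2 MnR.
  by rewrite mulrDr h1; lra.
apply/cvgrPdist_le => e e0.
have [K hK] := cdf_cvg_in_probability y01 p0 T0 size_sp sp_ge0 stieltjes x eps0 e0.
exists K => // k /= /hK h; rewrite sub0r normrN ger0_norm ?divr_ge0//.
apply: le_trans h; rewrite /dev_prob cT.
rewrite le_eqVlt; apply/orP; left; apply/eqP; congr (_%:R / _).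
by apply: eq_card => s; rewrite !inE esd_spectrum.
Qed.
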